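(* Let $X$ be a separable Banach space such that for some nonquasireflexive Banach space $Y$ there exists a surjective strictly singular operator $T:X\to Y$. Then for every countable ordinal $\alpha$ there exists a subspace $M$ of $X^*$ such that $M_{(\alpha+1)}=X^*$ and for every ordinal $\beta<\alpha$ the subspace $M_{(\beta)}\subset X^*$ is nowhere norming.
   Context: ''Operator'' means bounded linear operator. A subspace is a linear subspace, not necessarily norm closed. $X^*$ is the dual of the Banach space $X$; $S(M)$ denotes the unit sphere $\{f\in M:\|f\|=1\}$ of a subspace $M$. A Banach space $Y$ is quasireflexive if $Y^{**}/Y$ (with $Y$ canonically embedded in $Y^{**}$) is finite-dimensional; nonquasireflexive means not quasireflexive. An operator $T:X\to Y$ is strictly singular if its restriction to any infinite-dimensional subspace of $X$ is not an isomorphism onto its image. A subspace $M$ of $X^*$ is norming over a subspace $L$ of $X$ if there is $c>0$ such that $\sup_{f\in S(M)}|f(x)|\ge c\|x\|$ for all $x\in L$. $M$ is nowhere norming if it is not norming over any infinite-dimensional subspace of $X$. For a subset $M$ of $X^*$, the weak$^*$ sequential closure $M_{(1)}$ is the set of all limits of weak$^*$ convergent sequences of elements of $M$. For an ordinal $\alpha\geq 1$, the weak$^*$ sequential closure of order $\alpha$ is $M_{(\alpha)}=\bigcup_{\beta<\alpha}(M_{(\beta)})_{(1)}$, with $M_{(0)}=M$. If $M$ is a subspace then every $M_{(\alpha)}$ is a subspace. *)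

(* Defs.v *)
From HB Require Import structures.
From mathcomp Require Import all_boot all_order all_algebra.
From mathcomp Require Import all_classical all_reals all_analysis.
Import Order.TTheory GRing.Theory Num.Theory numFieldNormedType.Exports.

Set Implicit Arguments.
Unset Strict Implicit.
Unset Printing Implicit Defensive.

Local Open Scope classical_set_scope.
Local Open Scope ring_scope.

Section Dual.
Context {R : realType}.

Definition dual_pred (X : normedModType R) : {pred X -> R^o} :=
  [pred f : X -> R^o | `[< linear f /\ continuous f >]].
Arguments dual_pred : clear implicits.

Lemma dual_predP (X : normedModType R) (f : X -> R^o) :
  reflect (linear f /\ continuous f) (f \in dual_pred X).
Proof. exact: asboolP. Qed.

Record dual (X : normedModType R) :=
  Dual { dual_fun :> X -> R^o ; _ : dual_fun \in dual_pred X }.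

HB.instance Definition _ X := [isSub for @dual_fun X].
HB.instance Definition _ X := [Choice of dual X by <:].

Section Lmodule.
Variable X : normedModType R.
Implicit Types f g : dual X.

Lemma dual_submod_closed : submod_closed (dual_pred X).
Proof.
split=> [|a f g].
  apply/dual_predP; split; first by move=> a u v; rewrite scaler0 addr0.
  by move=> x; exact: cvg_cst.
move=> /dual_predP[lf cf] /dual_predP[lg cg]; apply/dual_predP; split.
  move=> b u v; rewrite !fctE lf lg !scalerDr !scalerA (mulrC a b).
  by rewrite addrACA.
move=> x; apply: (@cvgD _ R^o _ _ _ (a \*: f) g); last exact: cg.
by apply: cvgZl_tmp; exact: cf.
Qed.

HB.instance Definition _ :=
  GRing.isSubmodClosed.Build R (X -> R^o) (dual_pred X) dual_submod_closed.
HB.instance Definition _ := [SubChoice_isSubLmodule of dual X by <:].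

Lemma dual_linear f : linear (f : X -> R^o).
Proof. by case: f => f /= /dual_predP[]. Qed.

Lemma dual_continuous f : continuous (f : X -> R^o).
Proof. by case: f => f /= /dual_predP[]. Qed.

HB.instance Definition _ f :=
  GRing.isLinear.Build R X R^o *:%R (f : X -> R^o) (dual_linear f).

Lemma dualP f g : (forall x, f x = g x) -> f = g.
Proof. by move=> fg; apply/val_inj/funext. Qed.

Lemma dual_addE f g x : (f + g) x = f x + g x.
Proof. by []. Qed.

Lemma dual_scaleE (a : R) f x : (a *: f) x = a * f x.
Proof. by []. Qed.

Definition dual_norm f : R := sup [set `|f x : R| | x in [set x | `|x| <= 1]].

Lemma dual_has_sup f : has_sup [set `|f x : R| | x in [set x | `|x| <= 1]].
Proof.
split; first by exists `|f 0|, 0 => //=; rewrite normr0.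
have /linear_boundedP := continuous_linear_bounded 0 (@dual_continuous f 0).
move=> [r [_ /(_ (`|r| + 1))]]; rewrite (le_lt_trans (ler_norm _)) ?ltrDl//.
move=> /(_ isT) fr; exists (`|r| + 1) => _ [x /= x1 <-].
by rewrite (le_trans (fr x))// ler_piMr// addr_ge0.
Qed.

Lemma dual_norm_ub f x : `|f x| <= dual_norm f * `|x|.
Proof.
have [->|x0] := eqVneq x 0; first by rewrite linear0 !normr0 mulr0.
have nx0 : 0 < `|x| by rewrite normr_gt0.
rewrite -ler_pdivrMr//; apply: (ub_le_sup (dual_has_sup f).2).
exists (`|x|^-1 *: x) => /=.
  by rewrite normrZ normfV normr_id mulVf// gt_eqF.
by rewrite linearZ/= normrM normfV normr_id mulrC.
Qed.

Lemma dual_norm_le f (c : R) : 0 <= c ->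
  (forall x, `|f x| <= c * `|x|) -> dual_norm f <= c.
Proof.
move=> c0 fc; apply: ge_sup; first exact: (dual_has_sup f).1.
by move=> _ [x /= x1 <-]; rewrite (le_trans (fc x))// ler_piMr.
Qed.

Lemma dual_norm_ge0 f : 0 <= dual_norm f.
Proof.
apply: (ub_le_sup (dual_has_sup f).2).
by exists 0; rewrite /= ?normr0// linear0 normr0.
Qed.

Lemma dual_normD f g : dual_norm (f + g) <= dual_norm f + dual_norm g.
Proof.
apply: dual_norm_le => [|x]; first by rewrite addr_ge0// dual_norm_ge0.
rewrite dual_addE mulrDl (le_trans (ler_normD _ _))//.
by rewrite lerD// dual_norm_ub.
Qed.

Lemma dual_normZ (a : R) f : dual_norm (a *: f) = `|a| * dual_norm f.
Proof.
apply/eqP; rewrite eq_le; apply/andP; split.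
  apply: dual_norm_le => [|x]; first by rewrite mulr_ge0// dual_norm_ge0.
  by rewrite dual_scaleE normrM -mulrA ler_wpM2l// dual_norm_ub.
have [->|a0] := eqVneq a 0.
  by rewrite normr0 mul0r dual_norm_ge0.
rewrite -ler_pdivlMl ?normr_gt0//; apply: dual_norm_le => [|x].
  by rewrite mulr_ge0// dual_norm_ge0.
rewrite -mulrA ler_pdivlMl ?normr_gt0// -normrM -dual_scaleE.
exact: dual_norm_ub.
Qed.

Lemma dual_norm_eq0 f : dual_norm f = 0 -> f = 0.
Proof.
move=> f0; apply: dualP => x; have := dual_norm_ub f x.
by rewrite f0 mul0r normr_le0 => /eqP.
Qed.

HB.instance Definition _ :=
  Lmodule_isNormed.Build R (dual X) dual_normD dual_normZ dual_norm_eq0.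

End Lmodule.

Lemma dual_normE (X : normedModType R) (f : dual X) :
  `|f| = sup [set `|f x : R| | x in [set x | `|x| <= 1]].
Proof. by []. Qed.

Lemma bidual_embed_subproof (X : normedModType R) (x : X) :
  (fun f : dual X => f x) \in dual_pred (dual X).
Proof.
have lin : linear ((fun f : dual X => f x) : dual X -> R^o) by [].
apply/dual_predP; split=> //.
pose E : {linear dual X -> R^o} :=
  HB.pack ((fun f : dual X => f x) : dual X -> R^o)
    (GRing.isLinear.Build R (dual X) R^o *:%R _ lin).
apply: (@bounded_linear_continuous _ _ _ E).
apply/linear_boundedP; exists `|x|; split; first exact: normr_real.
move=> r xr f; rewrite (le_trans (dual_norm_ub f x))// mulrC.
by rewrite ler_wpM2r ?dual_norm_ge0// ltW.
Qed.

Definition bidual_embed (X : normedModType R) (x : X) : dual (dual X) :=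
  Dual (bidual_embed_subproof x).

End Dual.

Section Subspaces.
Context {R : realType}.

Definition is_subspace (V : lmodType R) (L : set V) :=
  L 0 /\ forall (a : R) (u v : V), L u -> L v -> L (a *: u + v).

Definition finite_dim (V : lmodType R) (L : set V) :=
  exists (n : nat) (e : 'I_n -> V),
    L `<=` [set v | exists a : 'I_n -> R, v = \sum_i a i *: e i].

(* [V / W] is finite-dimensional: it is spanned by finitely many classes. *)
Definition finite_codim (V : lmodType R) (W : set V) :=
  exists (n : nat) (e : 'I_n -> V), forall v : V,
    exists (a : 'I_n -> R) (w : V), W w /\ v = \sum_i a i *: e i + w.

Definition quasireflexive (Y : normedModType R) :=
  finite_codim (range (@bidual_embed R Y)).

Definition separable_space (X : topologicalType) :=
  exists D : set X, countable D /\ dense D.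

(* A homeomorphism of [L] onto [T @` L]; the inverse [S] matters only there and
   is automatically linear there when [T] is linear and [L] is a subspace. *)
Definition iso_onto_image (X Y : normedModType R) (T : X -> Y) (L : set X) :=
  {within L, continuous T} /\
  exists S : Y -> X,
    (forall x, L x -> S (T x) = x) /\ {within T @` L, continuous S}.

Definition strictly_singular (X Y : normedModType R) (T : X -> Y) :=
  forall L : set X, is_subspace L -> ~ finite_dim L -> ~ iso_onto_image T L.

(* [sup set0 = 0], so [M = 0] is norming over no nonzero subspace. *)
Definition norming (X : normedModType R) (M : set (dual X)) (L : set X) :=
  exists2 c : R, 0 < c &
    forall x, L x -> c * `|x| <= sup [set `|f x : R| | f in [set f | M f /\ `|f| = 1]].

Definition nowhere_norming (X : normedModType R) (M : set (dual X)) :=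
  forall L : set X, is_subspace L -> ~ finite_dim L -> ~ norming M L.

Definition wstar_cvg (X : normedModType R) (u : nat -> dual X) (f : dual X) :=
  forall x : X, (u n x : R) @[n --> \oo] --> (f x : R).

Definition wstar_seq_closure (X : normedModType R) (M : set (dual X)) :
    set (dual X) :=
  [set f | exists u : nat -> dual X, (forall n, M (u n)) /\ wstar_cvg u f].

End Subspaces.

(* Isomorphic well-orders represent the same ordinal; every notion below is
   invariant under isomorphism. *)
Record Ord := MkOrd {
  ord_sort :> Type ;
  ord_rel : ord_sort -> ord_sort -> Prop ;
  ord_trans : forall x y z, ord_rel x y -> ord_rel y z -> ord_rel x z ;
  ord_trichotomy : forall x y, ord_rel x y \/ x = y \/ ord_rel y x ;
  ord_wf : well_founded ord_rel }.

(* [b] is isomorphic to a proper initial segment of [a]. *)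
Definition ord_lt (b a : Ord) : Prop :=
  exists (f : b -> a) (i : a),
    (forall x y, ord_rel x y -> ord_rel (f x) (f y)) /\
    range f = [set j | ord_rel j i].

Lemma ord_lt_wf : well_founded ord_lt.
Proof.
move=> a; split=> b [f [i [fmono frange]]].
elim/(well_founded_ind (@ord_wf a)): i b f fmono frange => i IH b f fmono frange.
split=> c [g [j [gmono grange]]].
apply: (IH (f j) _ c (f \o g)) => [||].
- by have : range f (f j) by [exists j]; rewrite frange.
- by move=> x y xy; apply/fmono/gmono.
- apply/seteqP; split=> [_ [x _ <-]|k /= kj].
    by apply: fmono; have : range g (g x) by [exists x]; rewrite grange.
  have : range f k.
    rewrite frange; apply: ord_trans kj _.
    by have : range f (f j) by [exists j]; rewrite frange.
  move=> [y _ yk]; subst k.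
  have : range g y.
    rewrite grange /=; have [//|[yj|jy]] := ord_trichotomy y j.
      by subst y; exfalso; elim/(well_founded_ind (@ord_wf a)):
        (f j) kj => z IHz zz; exact: (IHz z).
    exfalso; have zz := ord_trans kj (fmono _ _ jy).
    by elim/(well_founded_ind (@ord_wf a)): (f y) zz => z IHz zz; exact: (IHz z).
  by move=> [x _ <-]; exists x.
Qed.

Definition ord_succ_rel (a : Ord) (x y : option a) : Prop :=
  match x, y with
  | Some u, Some v => ord_rel u v
  | Some _, None => True
  | None, _ => False
  end.

Lemma ord_succ_trans (a : Ord) (x y z : option a) :
  ord_succ_rel x y -> ord_succ_rel y z -> ord_succ_rel x z.
Proof. by case: x y z => [x|] [y|] [z|] //=; exact: ord_trans. Qed.

Lemma ord_succ_trichotomy (a : Ord) (x y : option a) :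
  ord_succ_rel x y \/ x = y \/ ord_succ_rel y x.
Proof.
case: x y => [x|] [y|] /=; [|by left|by right; right|by right; left].
by have [|[->|]] := ord_trichotomy x y; [left|right; left|right; right].
Qed.

Lemma ord_succ_wf (a : Ord) : well_founded (@ord_succ_rel a).
Proof.
have accS : forall x : a, Acc (@ord_succ_rel a) (Some x).
  apply: (well_founded_ind (@ord_wf a)) => x IH; apply: Acc_intro.
  by case=> [y yx|[]]; apply: IH.
case=> [x|]; first exact: accS.
by apply: Acc_intro; case=> [y _|[]]; apply: accS.
Qed.

Definition ord_succ (a : Ord) : Ord :=
  MkOrd (@ord_succ_trans a) (@ord_succ_trichotomy a) (@ord_succ_wf a).

Section TransfiniteClosure.
Context {R : realType} {X : normedModType R}.

(* [a -> False] says that [a] is the ordinal 0. The recursion is on ordinals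
   themselves; [wstar_closureE] is the resulting fixpoint equation. *)
Definition wstar_closure_step (M : set (dual X)) (a : Ord)
    (clo : forall b, ord_lt b a -> set (dual X)) : set (dual X) :=
  [set f | (a -> False) /\ M f \/
           exists b (ba : ord_lt b a), wstar_seq_closure (clo b ba) f].

Definition wstar_closure (M : set (dual X)) : Ord -> set (dual X) :=
  Fix ord_lt_wf (fun=> set (dual X)) (wstar_closure_step M).

Lemma wstar_closureE (M : set (dual X)) a : wstar_closure M a =
  [set f | (a -> False) /\ M f \/
           exists b (_ : ord_lt b a), wstar_seq_closure (wstar_closure M b) f].
Proof.
rewrite /wstar_closure Fix_eq// => b F G FG.
by have -> : F = G by apply/functional_extensionality_dep => c; exact/funext.
Qed.

Lemma wstar_closure0 (M : set (dual X)) (a : Ord) : (a -> False) ->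
  wstar_closure M a = M.
Proof.
move=> a0; rewrite wstar_closureE; apply/seteqP; split=> [f|f Mf]; last by left.
by case=> [[]//|[b [[_ [i _]]]]]; have := a0 i.
Qed.

Lemma wstar_closure_bigcup (M : set (dual X)) (a : Ord) (i : a) : wstar_closure M a =
  \bigcup_(b in [set b | ord_lt b a]) wstar_seq_closure (wstar_closure M b).
Proof.
rewrite wstar_closureE; apply/seteqP; split=> f.
  by case=> [[/(_ i)]//|[b [ba bf]]]; exists b.
by case=> b ba bf; right; exists b, ba.
Qed.

End TransfiniteClosure.

(* Main.v *)
Require Import Defs.
From HB Require Import structures.
From mathcomp Require Import all_boot all_order all_algebra.
From mathcomp Require Import all_classical all_reals all_analysis.
From mathcomp Require Import ring lra.
Import Order.TTheory GRing.Theory Num.Theory numFieldNormedType.Exports.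
Set Implicit Arguments.
Unset Strict Implicit.
Unset Printing Implicit Defensive.

Local Open Scope classical_set_scope.
Local Open Scope ring_scope.

(** The adjoint of T embeds the dual of Y isomorphically into the dual of X,
and its range is nowhere norming because T is strictly singular.  The space M
consists of functionals T^* y + \sum_k b_k f_k, where the f_k are weak* sequentially
dense in the dual of X, and it is arranged that on every closure of order less
than alpha all but finitely many of the b_k stay bounded by delta_k |y|, with
very small delta_k, whereas each f_k itself belongs to the closure of order alpha.  On these
closures a functional then acts on vectors x killed by many f_k almost as
T^* y does, hence it is small at some x in any infinite-dimensional subspace
(tame_nowhere_norming); and closing once more after alpha yields everything
(closure_full).

The bound on b_k is lost as late as desired thanks to a discontinuity of the
weak* topology on bounded sets of the dual of Y, which is where
nonquasireflexivity enters.  From infinitely many functionals on the dual of Y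
that are independent modulo Y one builds a biorthogonal array (z_{p,n}, w_{p,n})
such that, in each row p, the partial sums of the z_{p,n} are bounded and the
w_{p,n} tend to 0 weak* (nonquasireflexive_array): the bounded functional
y |-> \sum_n y(z_{p,n}) equals 1 on a weak* null sequence.

The rows are indexed by the nodes of a well-founded forest whose nodes carry
labels in alpha: the roots have labels cofinal in alpha, the children of a node
labelled i have labels cofinal below i, and they are leaves when i is least.
A node s carries the vertex f_k + T^* u_s, where k is its root, u_k = 0 and
u_{n::s} = u_s + cost(s) w_{s,n}.  The children of s converge weak* to s, so the
vertex of a node labelled i is reached from the leaves one step after the
ordinal i, and M is the span of the leaves (vertex_closure).

Conversely, put tau_{[k]} = b_k and tau_{n::s} = y(z_{s,n}) / cost(s).  On M
one has tau_s = \sum_n tau_{n::s} for every node s that is not a leaf, and this sum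
is bounded by |y| times the bound of the row s divided by cost(s).  This identity at s passes
to the closure of order j when j does not exceed the label of s: for almost all
children it holds at the previous stage, so that the series is dominated and may
be summed term by term in the limit, each single term being weak* continuous
(tame_closure).  The data of the limit are limits along an ultrafilter.
Only finitely many roots have a label below a given ordinal; their coefficients
are controlled because the f_k are chosen independent modulo
the closed range of T^* (independent_lower_bound), and the delta_k are chosen
small compared with the constants of this independence. *)

(** * Bounded functionals *)

Section DualArithmetic.
Context (R : realType) (X : normedModType R).
Implicit Types (f g : dual X) (x y : X).

Lemma dualD f x y : f (x + y) = f x + f y :> R. Proof. exact: linearD. Qed.
Lemma dualB f x y : f (x - y) = f x - f y :> R. Proof. exact: linearB. Qed.
Lemma dualZ f (a : R) x : f (a *: x) = a * f x :> R. Proof. exact: linearZ. Qed.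
Lemma dual_ub f x : `|f x| <= `|f| * `|x|. Proof. exact: dual_norm_ub. Qed.
Lemma dual0 f : f 0 = 0 :> R. Proof. exact: linear0. Qed.
Lemma dual_sum f n (x : nat -> X) :
  f (\sum_(i < n) x i) = \sum_(i < n) f (x i) :> R.
Proof. exact: linear_sum. Qed.
Lemma dual_subE f g x : (f - g) x = f x - g x :> R. Proof. by []. Qed.
Lemma dual_sumE n (f : nat -> dual X) x :
  (\sum_(i < n) f i) x = \sum_(i < n) f i x :> R.
Proof.
elim: n => [|n IH]; first by rewrite !big_ord0.
by rewrite !big_ord_recr dual_addE IH.
Qed.

End DualArithmetic.

Lemma dual_of_bound (R : realType) (X : normedModType R) (f : X -> R) (K : R) :
  (forall a u v, f (a *: u + v) = a * f u + f v) ->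
  (forall x, `|f x| <= K * `|x|) ->
  0 <= K ->
  exists2 g : dual X, (forall x, g x = f x) & `|g| <= K.
Proof.
move=> lf bf K0.
have lin : linear (f : X -> R^o) by move=> a u v; rewrite lf.
have fP : (f : X -> R^o) \in @dual_pred R X.
  apply/dual_predP; split=> //.
  pose E : {linear X -> R^o} :=
    HB.pack (f : X -> R^o) (GRing.isLinear.Build R X R^o *:%R _ lin).
  apply: (@bounded_linear_continuous _ _ _ E).
  apply/linear_boundedP; exists K; split; first exact: num_real.
  move=> r Kr x; rewrite (le_trans (bf x))// ler_wpM2r//; exact: ltW.
exists (Dual fP) => //; exact: dual_norm_le.
Qed.

Lemma dual_norm_ball (R : realType) (X : normedModType R) (f : dual X) (r B : R) :
  0 < r -> (forall x, `|x| < r -> `|f x| <= B) -> r * `|f| <= B.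
Proof.
move=> r0 fB.
have B0 : 0 <= B by rewrite (le_trans _ (fB 0 _)) ?normr0.
rewrite mulrC -ler_pdivlMr//; apply: dual_norm_le; first by rewrite divr_ge0// ltW.
move=> x; rewrite mulrAC ler_pdivlMr// leNgt; apply/negP => H.
have fx0 : 0 < `|f x|.
  by rewrite lt_def normr_ge0 andbT; apply/eqP => fx; move: H; rewrite fx mul0r ltNge mulr_ge0.
have x0 : 0 < `|x|.
  by rewrite lt_def normr_ge0 andbT; apply/eqP => /eqP; rewrite normr_eq0 => /eqP x0;
    move: fx0; rewrite x0 linear0 normr0 ltxx.
pose s := (B * `|x| / `|f x| + r) / 2.
have sB : B * `|x| / `|f x| < r by rewrite ltr_pdivrMr// [r * _]mulrC.
have Bx0 : 0 <= B * `|x| / `|f x| by rewrite divr_ge0// mulr_ge0.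
have s0 : 0 < s by rewrite /s; lra.
have := fB ((s / `|x|) *: x); rewrite normrZ normrM normfV normr_id (gtr0_norm s0).
rewrite mulfVK ?gt_eqF// => sr.
have /sr : s < r by rewrite /s; lra.
rewrite linearZ/= normrM normrM normfV normr_id (gtr0_norm s0) mulrAC ler_pdivrMr//.
rewrite leNgt => /negP; apply; rewrite -ltr_pdivrMr// /s; lra.
Qed.

(** * Affine alternatives and Helly's theorem *)

Section ConvexAlternative.
Context (R : realType) (V : lmodType R).

Definition affine_fun (g : V -> R) := forall x y t,
  g ((1 - t) *: x + t *: y) = (1 - t) * g x + t * g y.

Definition convex_subset (C : set V) := forall x y t, C x -> C y -> 0 <= t -> t <= 1 ->
  C ((1 - t) *: x + t *: y).

(** Relative algebraic openness: a segment in [C] can be prolonged inside [C].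
Unlike openness, this is inherited by the intersection with a hyperplane. *)
Definition extensible (C : set V) := forall x y, C x -> C y ->
  exists2 t, 0 < t & C ((1 - - t) *: x + (- t) *: y).

(** If [h] takes both signs, convexity makes [-g/h] on [h > 0] lie below
[g/(-h)] on [h < 0], and the supremum of the former is the multiplier; the
inequality is strict because an affine function that is nonnegative on an
extensible set and positive somewhere vanishes nowhere. *)
Lemma two_affine_alternative (C : set V) (g h : V -> R) :
  affine_fun g -> affine_fun h -> convex_subset C -> extensible C ->
  (forall x, C x -> h x = 0 -> 0 < g x) ->
  exists a b : R, forall x, C x -> 0 < a * g x + b * h x.
Proof.
move=> ag ah cC eC gpos.
have [[x0 [Cx0 hx0]]|npos] := pselect (exists x, C x /\ 0 < h x); last first.
  have hle x : C x -> h x <= 0.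
    by move=> Cx; rewrite leNgt; apply/negP => hx; apply: npos; exists x.
  have [[y [Cy hy]]|nneg] := pselect (exists x, C x /\ h x < 0); last first.
    exists 1, 0 => x Cx; rewrite mul0r addr0 mul1r; apply: gpos => //.
    apply/eqP; rewrite eq_le hle//= leNgt; apply/negP => hx.
    by apply: nneg; exists x.
  exists 0, (-1) => x Cx; rewrite mul0r add0r mulN1r oppr_gt0 lt_neqAle hle// andbT.
  apply/eqP => hx; have [t t0 Ct] := eC _ _ Cx Cy.
  have := hle _ Ct; rewrite ah hx; nra.
have [[y0 [Cy0 hy0]]|nneg] := pselect (exists x, C x /\ h x < 0); last first.
  have hge x : C x -> 0 <= h x.
    by move=> Cx; rewrite leNgt; apply/negP => hx; apply: nneg; exists x.
  exists 0, 1 => x Cx; rewrite mul0r add0r mul1r lt_neqAle hge// andbT.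
  apply/eqP => hx; have [t t0 Ct] := eC _ _ Cx Cx0.
  have := hge _ Ct; rewrite ah -hx; nra.
have cmp x y : C x -> C y -> 0 < h x -> h y < 0 -> - g x / h x <= g y / - h y.
  move=> Cx Cy hx hy.
  have d0 : 0 < h x - h y by lra.
  pose t := h x / (h x - h y).
  have td : t * (h x - h y) = h x by rewrite /t divfK ?gt_eqF.
  have t0 : 0 <= t by rewrite /t divr_ge0 ?ltW.
  have t1 : t <= 1 by rewrite /t ler_pdivrMr// mul1r; lra.
  have := gpos _ (cC x y t Cx Cy t0 t1); rewrite ag ah.
  have -> : (1 - t) * h x + t * h y = h x - t * (h x - h y) by ring.
  rewrite td subrr => /(_ erefl) gt0.
  have : 0 < (h x - h y) * ((1 - t) * g x + t * g y) by rewrite mulr_gt0.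
  have -> : (h x - h y) * ((1 - t) * g x + t * g y) =
    (h x - h y) * g x + t * (h x - h y) * (g y - g x) by ring.
  rewrite td => H.
  rewrite ler_pdivrMr// mulrAC ler_pdivlMr; last by lra.
  nra.
pose A := [set - g x / h x | x in [set x | C x /\ 0 < h x]].
have supA : has_sup A.
  split; first by exists (- g x0 / h x0), x0.
  by exists (g y0 / - h y0) => _ [x [Cx hx] <-]; exact: cmp.
exists 1, (sup A).
have weak x : C x -> 0 <= g x + sup A * h x.
  move=> Cx; case: (ltgtP (h x) 0) => hx.
  - have : sup A <= g x / - h x.
      by apply: ge_sup; [exact: supA.1|move=> _ [y [Cy hy] <-]; exact: cmp].
    by rewrite ler_pdivlMr; lra.
  - have : - g x / h x <= sup A by apply: (ub_le_sup supA.2); exists x.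
    by rewrite ler_pdivrMr//; lra.
  - by rewrite hx mulr0 addr0 ltW// gpos.
move=> x Cx; rewrite mul1r lt_neqAle weak// andbT; apply/eqP => gx.
have hx : h x != 0.
  by apply/eqP => hx; have := gpos _ Cx hx; move: gx; rewrite hx mulr0; lra.
pose t := h x0 / (h x0 - h y0).
have d0 : 0 < h x0 - h y0 by lra.
have td : t * (h x0 - h y0) = h x0 by rewrite /t divfK ?gt_eqF.
have t0 : 0 <= t by rewrite /t divr_ge0 ?ltW.
have t1 : t <= 1 by rewrite /t ler_pdivrMr// mul1r; lra.
have Cz := cC x0 y0 t Cx0 Cy0 t0 t1.
set z := (1 - t) *: x0 + t *: y0 in Cz.
have hz : h z = 0.
  rewrite ah; have -> : (1 - t) * h x0 + t * h y0 = h x0 - t * (h x0 - h y0) by ring.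
  by rewrite td subrr.
have gz := gpos _ Cz hz.
have [s s0 Cs] := eC _ _ Cx Cz.
have := weak _ Cs; rewrite ag ah hz; nra.
Qed.

(** Separation from a point of finite-dimensional space, by induction on the
number of functions: the last one cuts [C] down to a slice, to which the
induction applies, and [two_affine_alternative] returns to [C].  [P] stands for
a space of affine functions, so that the linear combination found need not be
written down. *)
Lemma convex_alternative (P : set (V -> R)) (C : set V) (psi : nat -> V -> R) m :
  P (fun=> 0) ->
  (forall a b g h, P g -> P h -> P (fun x => a * g x + b * h x)) ->
  (forall g, P g -> affine_fun g) ->
  (forall i, P (psi i)) ->
  convex_subset C -> extensible C ->
  (exists2 x, C x & forall i, (i < m)%N -> psi i x = 0) \/
  (exists2 g, P g & forall x, C x -> 0 < g x).
Proof.
move=> P0 Plin Paff Ppsi; elim: m C => [|m IH] C cC eC.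
  have [[x Cx]|nC] := pselect (exists x, C x); first by left; exists x.
  by right; exists (fun=> 0) => // x Cx; exfalso; apply: nC; exists x.
pose C' := [set x | C x /\ psi m x = 0].
have ap := Paff _ (Ppsi m).
have [||[x [Cx px] pi]|[g Pg gp]] := IH C'.
- move=> x y t [Cx px] [Cy py] t0 t1; split; first exact: cC.
  by rewrite ap px py !mulr0 addr0.
- move=> x y [Cx px] [Cy py]; have [t t0 Ct] := eC _ _ Cx Cy.
  by exists t => //; split=> //; rewrite ap px py !mulr0 addr0.
- left; exists x => // i; rewrite ltnS leq_eqVlt => /predU1P[->//|]; exact: pi.
- right.
  have [x Cx px|a [b ab]] := two_affine_alternative (Paff _ Pg) ap cC eC.
    exact: gp.
  by exists (fun x => a * g x + b * psi m x) => //; exact: Plin.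
Qed.

End ConvexAlternative.

(** Otherwise [convex_alternative], applied to the open ball and to the functions
[phi x - Lam phi], gives some [f] with [f > Lam f] on the ball; so [r |f| <= |Lam f|],
which forces [f = 0] as [|Lam| < r], and then [0 > 0]. *)
Lemma helly (R : realType) (E : normedModType R) (Lam : dual (dual E))
    (phi : nat -> dual E) (m : nat) (r : R) : `|Lam| < r ->
  exists2 x : E, `|x| < r & forall i, (i < m)%N -> phi i x = Lam (phi i).
Proof.
move=> Lr.
have r0 : 0 < r by rewrite (le_lt_trans _ Lr).
pose P := [set g : E -> R | exists f : dual E, forall x, g x = f x - Lam f].
have [||||||[x Cx px]|] := @convex_alternative R E P [set x | `|x| < r]
    (fun i x => phi i x - Lam (phi i)) m.
- by exists 0 => x; rewrite linear0 subr0.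
- move=> a b g h [f fE] [k kE]; exists (a *: f + b *: k) => x.
  rewrite fE kE dual_addE !dual_scaleE linearP linearZ/= /GRing.scale/=; ring.
- by move=> g [f fE] x y t; rewrite !fE linearP linearZ/= /GRing.scale/=; ring.
- by move=> i; exists (phi i).
- move=> x y t /= xr yr t0 t1.
  rewrite (le_lt_trans (ler_normD _ _))// !normrZ (ger0_norm t0) ger0_norm ?subr_ge0//.
  have [->|] := eqVneq t 0; first by rewrite subr0 mul1r mul0r addr0.
  move=> tn; have : 0 < t by rewrite lt_def tn.
  by move=> tp; nra.
- move=> x y /= xr yr; pose D := `|x| + `|y| + 1.
  have D0 : 0 < D by rewrite ltr_pwDr// addr_ge0.
  exists ((r - `|x|) / D / 2) => /=.
    by rewrite !divr_gt0// subr_gt0.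
  set t := _ / 2; have t0 : 0 < t by rewrite /t !divr_gt0// subr_gt0.
  have tD : t * D * 2 = r - `|x| by rewrite /t; field; rewrite gt_eqF.
  rewrite (le_lt_trans (ler_normD _ _))// !normrZ opprK normrN (gtr0_norm t0).
  rewrite gtr0_norm; last by lra.
  have : t * `|x| + t * `|y| <= t * D by rewrite /D; nra.
  have : 0 < t * D by rewrite mulr_gt0.
  nra.
- exists x => // i im; apply/eqP; rewrite -subr_eq0; apply/eqP; exact: px.
- move=> [g [f fE] gpos]; exfalso.
  have fb x : `|x| < r -> `|f x| <= `|Lam| * `|f|.
    move=> xr; have := gpos x xr; have := gpos (- x).
    rewrite /= normrN => /(_ xr); rewrite !fE linearN.
    have : - (Lam f) <= `|Lam| * `|f|.
      by rewrite (le_trans _ (dual_ub Lam f))// ler_normr lexx orbT.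
    move=> H1 H2 H3; rewrite ler_norml; apply/andP; split; lra.
  have rf : r * `|f| <= `|Lam| * `|f|.
    exact: dual_norm_ball.
  have f0 : `|f| = 0.
    by apply/eqP; rewrite -normr_le0; have := normr_ge0 f; rewrite normr_id; nra.
  have := gpos 0; rewrite /= normr0 => /(_ r0); rewrite fE linear0.
  by rewrite (dual_norm_eq0 f0) linear0 subrr ltxx.
Qed.

(** * The Hahn-Banach theorem *)

Section HahnBanach.
Context (R : realType) (V : normedModType R).

(** The graph of a linear functional defined on a subspace and bounded by
[K |x|]; the third condition makes the relation single-valued. *)
Definition dominated_graph (K : R) (F : set (V * R)) :=
  [/\ F (0, 0), (forall (a : R) p q, F p -> F q -> F (a *: p.1 + q.1, a * p.2 + q.2))
    & forall p, F p -> p.2 <= K * `|p.1|].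

(** The classical one-dimensional step: the value at [v] may be anything between
the lower and upper bounds imposed by the points of the graph. *)
Lemma dominated_graph_extend (K : R) (F : set (V * R)) (v : V) : 0 <= K ->
  dominated_graph K F ->
  exists c, dominated_graph K [set p | exists q t, F q /\
     p = (q.1 + t *: v, q.2 + t * c)].
Proof.
move=> K0 [F0 Fl FK].
have cmp p q : F p -> F q -> p.2 - K * `|p.1 - v| <= K * `|q.1 + v| - q.2.
  move=> Fp Fq; have := FK _ (Fl 1 _ _ Fp Fq); rewrite /= scale1r mul1r => H.
  have : `|p.1 + q.1| <= `|p.1 - v| + `|q.1 + v|.
    by rewrite (_ : p.1 + q.1 = (p.1 - v) + (q.1 + v)) ?ler_normD// addrACA addNr addr0.
  nra.
pose A := [set p.2 - K * `|p.1 - v| | p in F].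
have supA : has_sup A.
  split; first by exists ((0:R) - K * `|(0 : V) - v|), (0, 0).
  by exists (K * `|(0 : V) + v| - 0) => _ [p Fp <-]; apply: (cmp p (0, 0)).
exists (sup A).
have lo p : F p -> p.2 - sup A <= K * `|p.1 - v|.
  move=> Fp; have : p.2 - K * `|p.1 - v| <= sup A by apply: (ub_le_sup supA.2); exists p.
  lra.
have hi p : F p -> p.2 + sup A <= K * `|p.1 + v|.
  move=> Fp; have : sup A <= K * `|p.1 + v| - p.2.
    by apply: ge_sup; [exact: supA.1|move=> _ [q Fq <-]; exact: cmp].
  lra.
have Fs (a : R) p : F p -> F (a *: p.1, a * p.2).
  by move=> Fp; have := Fl a _ _ Fp F0; rewrite /= !addr0.
split.
- by exists (0, 0), 0; rewrite /= scale0r mul0r !addr0.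
- move=> a _ _ [p [s [Fp ->]]] [q [t [Fq ->]]] /=.
  exists (a *: p.1 + q.1, a * p.2 + q.2), (a * s + t); split; first exact: Fl.
  by rewrite /= scalerDr scalerDl scalerA addrACA; congr (_, _); ring.
- move=> _ [p [t [Fp ->]]] /=.
  have [->|tn] := eqVneq t 0; first by rewrite scale0r mul0r !addr0; exact: FK.
  have [tp|tp] := ltP 0 t.
    have E : `|p.1 + t *: v| = t * `|t^-1 *: p.1 + v|.
      rewrite -{2}(gtr0_norm tp) -normrZ; congr (`|_|).
      by rewrite scalerDr scalerA mulfV// scale1r.
    have := hi _ (Fs t^-1 _ Fp); rewrite /= -(ler_pM2l tp) mulrDr mulrA mulfV// mul1r.
    by rewrite E mulrCA.
  have tp' : 0 < - t by rewrite oppr_gt0 lt_neqAle tn.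
  have tn' : - t != 0 by rewrite oppr_eq0.
  have E : `|p.1 + t *: v| = - t * `|(- t)^-1 *: p.1 - v|.
    rewrite -{1}(gtr0_norm tp') -normrZ; congr (`|_|).
    by rewrite scalerDr scalerA mulfV// scale1r scalerN scaleNr opprK.
  have := lo _ (Fs (- t)^-1 _ Fp).
  rewrite /= -(ler_pM2l tp') mulrDr mulrA mulfV// mul1r.
  by rewrite E mulrCA mulrNN.
Qed.

(** A maximal graph is total by [dominated_graph_extend].  Zorn's lemma is used on
the sets [G] such that [F `|` G] is a graph, which covers the empty chain. *)
Lemma hahn_banach (K : R) (F : set (V * R)) : 0 <= K -> dominated_graph K F ->
  exists2 f : dual V, (forall p, F p -> f p.1 = p.2) & `|f| <= K.
Proof.
move=> K0 gF.
pose P := [set G | dominated_graph K (F `|` G)].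
have [|A [PA Amax]] := @Zorn_bigcup (V * R) P.
  move=> C CP Ctot.
  have [[G0 CG0]|nC] := pselect (exists G, C G); last first.
    rewrite /P /= (_ : F `|` _ = F)//; apply/setUidPl => p [G CG]; exfalso.
    by apply: nC; exists G.
  have lift p : (F `|` \bigcup_(X in C) X) p -> exists2 G, C G & (F `|` G) p.
    by case=> [Fp|[G CG Gp]]; [exists G0 => //; left|exists G => //; right].
  have lift2 p q : (F `|` \bigcup_(X in C) X) p -> (F `|` \bigcup_(X in C) X) q ->
      exists2 G, C G & (F `|` G) p /\ (F `|` G) q.
    move=> /lift[G CG Gp] /lift[H CH Hq].
    by case: (Ctot _ _ CG CH) => sub; [exists H|exists G] => //; split=> //;
      [case: Gp => [?|/sub ?]; [left|right]|case: Hq => [?|/sub ?]; [left|right]].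
  split.
  - by left; case: gF.
  - move=> a p q Hp Hq; have [G CG [Gp Gq]] := lift2 _ _ Hp Hq.
    have [_ Gl _] := CP _ CG.
    by case: (Gl a _ _ Gp Gq) => ?; [left|right; exists G].
  - by move=> p /lift[G CG Gp]; have [_ _] := CP _ CG; apply.
set H := F `|` A in PA.
have [H0 Hl HK] := PA.
have tot v : exists r, H (v, r).
  apply: contrapT => nv.
  have [c gc] := dominated_graph_extend v K0 PA.
  set B := [set p | _] in gc.
  have HB : H `<=` B.
    by move=> [u r] Hp; exists (u, r), 0; rewrite /= scale0r mul0r !addr0.
  have Bv : B (v, c) by exists (0, 0), 1; rewrite /= scale1r mul1r !add0r.
  apply: (Amax B).
    split; first by move=> p Ap; apply: HB; right.
    by move=> BA; apply: nv; exists c; right; exact: BA.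
  rewrite /P /= (_ : F `|` B = B)//; apply/setUidPr => p Fp; apply: HB; by left.
have func v r s : H (v, r) -> H (v, s) -> r <= s.
  move=> Hr Hs; have := HK _ (Hl (-1) _ _ Hs Hr).
  by rewrite /= scaleN1r addNr normr0 mulr0 mulN1r; lra.
have funcE v r s : H (v, r) -> H (v, s) -> r = s.
  by move=> Hr Hs; apply/eqP; rewrite eq_le (func v r s)// (func v s r).
have [f Hf] := choice tot.
have flin a u v : f (a *: u + v) = a * f u + f v.
  exact: (funcE _ _ _ (Hf _) (Hl a _ _ (Hf u) (Hf v))).
have fub x : f x <= K * `|x| := HK _ (Hf x).
have [x|g gE gK] := dual_of_bound flin _ K0.
  rewrite ler_norml fub andbT.
  have : f (- x) = - f x.
    have f0 : f 0 = 0 by exact: (funcE 0).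
    by have := flin (-1) x 0; rewrite f0 !addr0 scaleN1r mulN1r.
  by have := fub (- x); rewrite normrN => + E; rewrite E; lra.
exists g => // -[v r] Fp; rewrite gE /=; apply: (funcE v) => //; by left.
Qed.

Lemma norming_functional (v : V) : exists2 f : dual V, `|f| <= 1 & f v = `|v|.
Proof.
have [||f fE f1] := @hahn_banach 1 [set p | exists t, p = (t *: v, t * `|v|)] => //.
  split.
  - by exists 0; rewrite scale0r mul0r.
  - move=> a _ _ [s ->] [t ->]; exists (a * s + t) => /=.
    by rewrite scalerA scalerDl mulrDl mulrA.
  - move=> _ [t ->] /=; rewrite mul1r normrZ ler_wpM2r//; exact: ler_norm.
exists f => //; have := fE (v, `|v|); apply; exists 1; by rewrite scale1r mul1r.
Qed.

End HahnBanach.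

(** * Closed subspaces *)

Section ClosedSubspaces.
Context (R : realType) (V : normedModType R).

Definition closed_subspace (W : set V) := is_subspace W /\
  forall v, (forall e, 0 < e -> exists2 w, W w & `|v - w| < e) -> W v.

Lemma subspaceN (W : set V) v : is_subspace W -> W v -> W (- v).
Proof. by move=> [W0 Wl] Wv; have := Wl (-1) _ _ Wv W0; rewrite scaleN1r addr0. Qed.

Lemma subspaceZ (W : set V) (a : R) v : is_subspace W -> W v -> W (a *: v).
Proof. by move=> [W0 Wl] Wv; have := Wl a _ _ Wv W0; rewrite addr0. Qed.

Lemma subspaceD (W : set V) u v : is_subspace W -> W u -> W v -> W (u + v).
Proof. by move=> [W0 Wl] Wu Wv; have := Wl 1 _ _ Wu Wv; rewrite scale1r. Qed.

Lemma closed_subspace_dist (W : set V) (v : V) : closed_subspace W -> ~ W v ->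
  exists2 c : R, 0 < c & forall w t, W w -> c * `|t| <= `|w + t *: v|.
Proof.
move=> [sW cW] nv.
have [e e0 ve] : exists2 e : R, 0 < e & forall w, W w -> e <= `|v - w|.
  apply: contrapT => H; apply: nv; apply: cW => e e0; apply: contrapT => H2.
  apply: H; exists e => // w Ww; rewrite leNgt; apply/negP => ?.
  by apply: H2; exists w.
exists e => // w t Ww; have [->|tn] := eqVneq t 0; first by rewrite normr0 mulr0.
have := ve _ (subspaceZ (- t^-1) sW Ww).
rewrite scaleNr opprK => H.
have -> : w + t *: v = t *: (v + t^-1 *: w).
  by rewrite scalerDr scalerA mulfV// scale1r addrC.
by rewrite normrZ mulrC ler_wpM2l.
Qed.

(** The sum of [W] and the line through [v] is topologically direct. *)
Lemma closed_subspace_decompose (W : set V) (v : V) :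
  closed_subspace W -> ~ W v ->
  exists2 c, 0 < c & forall w t, W w ->
    c * `|t| <= `|w + t *: v| /\ c * `|w| <= `|w + t *: v|.
Proof.
move=> cW nv; have [c c0 cP] := closed_subspace_dist cW nv.
have v0 : 0 < `|v| by rewrite normr_gt0; apply/eqP => v0; apply: nv; rewrite v0; case: cW => -[].
pose d := c / (c + `|v|).
have cv0 : 0 < c + `|v| by rewrite addr_gt0.
have d0 : 0 < d by rewrite divr_gt0.
exists (Num.min c d); first by rewrite lt_min c0.
move=> w t Ww; have H := cP w t Ww; split.
  by rewrite (le_trans _ H)// ler_wpM2r// ge_min lexx.
rewrite (@le_trans _ _ (d * `|w|))//; first by rewrite ler_wpM2r// ge_min lexx orbT.
rewrite /d mulrAC ler_pdivrMr//.
have Hw : `|w| <= `|w + t *: v| + `|t| * `|v|.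
  by rewrite -{1}[w](addrK (t *: v)) (le_trans (ler_normB _ _))// normrZ.
nra.
Qed.

(** [w + t v |-> t] is bounded because [v] has positive distance to [W]. *)
Lemma separating_functional (W : set V) (v : V) : closed_subspace W -> ~ W v ->
  exists2 f : dual V, (forall w, W w -> f w = 0) & f v = 1.
Proof.
move=> cW nv; have [c c0 cP] := closed_subspace_dist cW nv.
have [[W0 Wl] _] := cW.
have ci0 : 0 <= c^-1 by rewrite invr_ge0 ltW.
have [|f fE _] := hahn_banach (F := [set p | exists w t, W w /\ p = (w + t *: v, t)]) ci0.
  split.
  - by exists 0, 0; rewrite scale0r addr0.
  - move=> a _ _ [w [s [Ww ->]]] [w' [t [Ww' ->]]] /=.
    exists (a *: w + w'), (a * s + t); split; first exact: Wl.
    by rewrite scalerDr scalerDl scalerA addrACA.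
  - move=> _ [w [t [Ww ->]]] /=; rewrite mulrC ler_pdivlMr// mulrC.
    by rewrite (le_trans _ (cP _ _ Ww))//; apply: ler_wpM2l (ler_norm t); exact: ltW.
exists f => [w Ww|].
  by have := fE (w, 0); apply; exists w, 0; rewrite scale0r addr0.
by have := fE (v, 1); apply; exists 0, 1; rewrite scale1r add0r.
Qed.

(** Along an approximation of [u] by [w + t v], the coefficient [t] is determined up
to a small error by a functional that vanishes on [W]; hence [w] approximates
[u - f u *: v]. *)
Lemma closed_subspace_add_line (W : set V) (v : V) : closed_subspace W -> ~ W v ->
  closed_subspace [set u | exists w t, W w /\ u = w + t *: v].
Proof.
move=> cW nv; have [f fW fv] := separating_functional cW nv.
have [[W0 Wl] clW] := cW.
split; first split.
- by exists 0, 0; rewrite scale0r addr0.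
- move=> a _ _ [w [s [Ww ->]]] [w' [t [Ww' ->]]] /=.
  exists (a *: w + w'), (a * s + t); split; first exact: Wl.
  by rewrite scalerDr scalerDl scalerA addrACA.
move=> u uW; exists (u - f u *: v), (f u); split; last by rewrite subrK.
apply: clW => e e0.
pose D := 1 + `|f| * `|v|.
have D0 : 0 < D by rewrite ltr_pwDl// mulr_ge0.
have [_ [w [t [Ww ->]]] H] := uW (e / D) (divr_gt0 e0 D0).
exists w => //.
have fz : f (u - (w + t *: v)) = f u - t.
  by rewrite dualB dualD (fW _ Ww) dualZ fv add0r mulr1.
have E : u - f u *: v - w = (u - (w + t *: v)) - f (u - (w + t *: v)) *: v.
  rewrite fz scalerBl opprB opprD -!addrA; congr (_ + _).
  by rewrite addKr addrC.
rewrite E (le_lt_trans (ler_normB _ _))// normrZ.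
set z := u - _ in H *.
have : `|f z| * `|v| <= `|f| * `|z| * `|v| by rewrite ler_wpM2r// dual_ub.
move: H; rewrite ltr_pdivlMr// /D; lra.
Qed.

End ClosedSubspaces.

(** * Generalized limits *)

Section GeneralizedLimit.
Context (R : realType).
Implicit Types u v : nat -> R.

Definition bounded_seq u := exists K, forall n, `|u n| <= K.

(** Evaluated pointwise, such an [L] picks a weak* cluster point of a bounded
sequence of functionals. *)
Definition generalized_limit (L : (nat -> R) -> R) :=
  [/\ forall a u v, bounded_seq u -> bounded_seq v ->
         L (fun n => a * u n + v n) = a * L u + L v,
      forall u K, (forall n, `|u n| <= K) -> `|L u| <= K &
      forall u (l : R), u n @[n --> \oo] --> l -> L u = l].

(** [L] is the limit along an ultrafilter finer than the Frechet filter. *)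
Lemma generalized_limit_exists : exists L, generalized_limit L.
Proof.
have [U [UU sU]] := ultraFilterLemma (eventually_filter : ProperFilter (\oo : set_system nat)).
have PU : ProperFilter U by exact: ultra_proper.
pose L u := lim (u @ U).
have cvgL u K : (forall n, `|u n| <= K) -> u @ U --> L u /\ `|L u| <= K.
  move=> uK.
  have /(_ (u @ U) _ _)[||l [lK ul]] : forall F : set_system R, UltraFilter F -> F `[- K, K]%classic ->
      `[- K, K]%classic `&` [set p | F --> p] !=set0.
    have := @segment_compact R (- K) K; rewrite compact_ultra; exact.
  - split; first exact: fmap_proper_filter.
    move=> G PG sG; apply/seteqP; split=> A; last exact: sG.
    move=> GA; have [//|nA] := @in_ultra_setVsetC _ U (u @^-1` A) UU.
    have GnA : G (~` A) by apply: sG.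
    by have := @filterI _ G _ _ _ GA GnA; rewrite setICr => /(_ _) G0; have [] := @filter_ex _ G PG _ G0.
  - by apply: (@filterE _ U) => n /=; rewrite in_itv/= -ler_norml; exact: uK.
  have E : L u = l by apply: cvg_lim => //; exact: Rhausdorff.
  rewrite E; split=> //; move: lK; by rewrite /= in_itv/= -ler_norml.
exists L; split.
- move=> a u v [Ku uK] [Kv vK].
  have [cu _] := cvgL _ _ uK; have [cv _] := cvgL _ _ vK.
  apply: cvg_lim; first exact: Rhausdorff.
  by apply: cvgD => //; apply: cvgM => //; exact: cvg_cst.
- by move=> u K uK; have [] := cvgL _ _ uK.
- move=> u l ul; apply: cvg_lim; first exact: Rhausdorff.
  by apply: cvg_trans ul; apply: cvg_app; exact: sU.
Qed.

End GeneralizedLimit.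

(** * Biorthogonal systems modulo a closed subspace *)

Section StrongRecursion.
Context (T : Type) (P : nat -> (nat -> T) -> T -> Prop).

(** Dependent choice in which each new term is constrained by all the earlier ones. *)
Lemma history_choice (d : T) :
  (forall n h h' x, (forall i, (i < n)%N -> h i = h' i) -> P n h x -> P n h' x) ->
  (forall n h, (forall i, (i < n)%N -> P i h (h i)) -> exists x, P n h x) ->
  exists h, forall n, P n h (h n).
Proof.
move=> ext ex.
have /choice[next nextP] (nh : nat * (nat -> T)) :
    exists y, (exists x, P nh.1 nh.2 x) -> P nh.1 nh.2 y.
  by have [[x Px]|nx] := pselect (exists x, P nh.1 nh.2 x); [exists x|exists d].
pose F := fix F n : nat -> T :=
  if n is m.+1 then fun i => if i == m then next (m, F m) else F m i else fun=> d.
pose h i := F i.+1 i.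
have Fh n i : (i < n)%N -> F n i = h i.
  elim: n => // n IH; rewrite ltnS leq_eqVlt => /predU1P[->//|lin] /=.
  by rewrite ltn_eqF// IH.
exists h; elim/ltn_ind => n IH.
have hE : h n = next (n, F n) by rewrite /h /= eqxx.
rewrite hE; apply: (ext _ (F n)) => [i|]; first exact: Fh.
apply: (nextP (n, F n)); have [x Px] := ex n h IH; exists x.
by apply: ext Px => i lin; rewrite /= Fh.
Qed.

End StrongRecursion.

Section SpanModulo.
Context (R : realType) (V : normedModType R).

Definition span_mod (W : set V) (e : nat -> V) (n : nat) : set V :=
  [set v | exists (a : nat -> R) w, W w /\ v = \sum_(i < n) a i *: e i + w].

Lemma span_mod_sub W e n : W `<=` span_mod W e n.
Proof.
by move=> w Ww; exists (fun=> 0), w; split=> //; rewrite big1 ?add0r// => i _; rewrite scale0r.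
Qed.

Lemma span_modS W e n :
  span_mod W e n.+1 = [set u | exists w t, span_mod W e n w /\ u = w + t *: e n].
Proof.
apply/seteqP; split=> [_ [a [w [Ww ->]]]|_ [_ [t [[a [w [Ww ->]]] ->]]]].
  exists (\sum_(i < n) a i *: e i + w), (a n); split; first by exists a, w.
  by rewrite big_ord_recr /= addrAC.
exists (fun i => if i == n then t else a i), w; split=> //.
rewrite big_ord_recr /= eqxx addrAC; congr (_ + _ + _).
by apply: eq_bigr => i _; rewrite ltn_eqF.
Qed.

Lemma span_mod0 W e : span_mod W e 0 = W.
Proof.
apply/seteqP; split=> [_ [a [w [Ww ->]]]|]; last exact: span_mod_sub.
by rewrite big_ord0 add0r.
Qed.

Lemma span_mod_closed (W : set V) (e : nat -> V) n :
  closed_subspace W -> closed_subspace (span_mod W e n).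
Proof.
move=> cW; elim: n => [|n IH]; first by rewrite span_mod0.
rewrite span_modS; have [en|nen] := pselect (span_mod W e n (e n)); last first.
  exact: closed_subspace_add_line.
rewrite (_ : [set u | _] = span_mod W e n)//; apply/seteqP; split=> [_ [w [t [Sw ->]]]|w Sw].
  by apply: subspaceD => //; [case: IH|apply: subspaceZ => //; case: IH].
by exists w, 0; rewrite scale0r addr0.
Qed.

Lemma span_mod_proper W e n : ~ finite_codim W -> exists v, ~ span_mod W e n v.
Proof.
move=> nW; apply: contrapT => H; apply: nW; exists n, (fun i : 'I_n => e i) => v.
have [a [w [Ww vE]]] : span_mod W e n v.
  by apply: contrapT => nv; apply: H; exists v.
by exists (fun i : 'I_n => a i), w.
Qed.

Lemma span_mod_ext W e e' n : (forall i, (i < n)%N -> e i = e' i) ->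
  span_mod W e n `<=` span_mod W e' n.
Proof.
move=> ee _ [a [w [Ww ->]]]; exists a, w; split=> //; congr (_ + _).
by apply: eq_bigr => i _; rewrite ee.
Qed.

(** Given the first [n] pairs, subtracting a combination of the [G i] makes a vector outside
[W + span G] annihilated by all earlier [L i]; the new functional separates
it from the closed subspace [W + span G]. *)
Lemma biorthogonal_mod (W : set V) : closed_subspace W -> ~ finite_codim W ->
  exists (G : nat -> V) (L : nat -> dual V),
    (forall p w, W w -> L p w = 0) /\ (forall p q, L p (G q) = (p == q)%:R).
Proof.
move=> cW nW.
pose P n (h : nat -> V * dual V) (x : V * dual V) :=
  [/\ forall w, W w -> x.2 w = 0, forall i, (i < n)%N -> x.2 (h i).1 = 0,
      forall i, (i < n)%N -> (h i).2 x.1 = 0 & x.2 x.1 = 1].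
have [|n h hP|h hP] := @history_choice _ P (0, 0).
- move=> n h h' x hh [xW x1 x2 x3]; split=> // i lin; rewrite -hh//.
    exact: x1.
  exact: x2.
- have [v nv] := span_mod_proper (fun i => (h i).1) n nW.
  set e := fun i => (h i).1 in nv.
  have lam i j : (i < n)%N -> (j < n)%N -> (h i).2 (e j) = (i == j)%:R.
    move=> lin ljn; case: (ltngtP i j) => [ij|ji|<-].
    + by have [_ _ /(_ _ ij)] := hP _ ljn.
    + by have [_ /(_ _ ji)] := hP _ lin.
    + by have [] := hP _ lin.
  have cS := span_mod_closed e n cW.
  pose g := v - \sum_(i < n) (h i).2 v *: e i.
  have ng : ~ span_mod W e n g.
    move=> Sg; apply: nv; rewrite (_ : v = g + \sum_(i < n) (h i).2 v *: e i); last by rewrite subrK.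
    apply: subspaceD => //; first by case: cS.
    exists (fun i => (h i).2 v), 0; split; last by rewrite addr0.
    by case: cW => -[].
  have [l lW lg] := separating_functional cS ng.
  exists (g, l); split=> //=.
  + by move=> w Ww; apply: lW; exact: span_mod_sub.
  + move=> i lin; apply: lW; exists (fun k => (k == i)%:R), 0; split; first by case: cW => -[].
    rewrite addr0 (bigD1 (Ordinal lin))//= eqxx scale1r big1 ?addr0// => k ki.
    by rewrite (_ : (k == i :> nat) = false) ?scale0r//; apply: contraNF ki => /eqP ki; apply/eqP/val_inj.
  + move=> i lin; rewrite /g dualB (dual_sum _ _ (fun k => (h k).2 v *: e k)).
    rewrite (bigD1 (Ordinal lin))//= dualZ lam// eqxx mulr1 big1 ?addr0 ?subrr// => k ki.
    rewrite dualZ lam// (_ : (i == k :> nat) = false) ?mulr0//.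
    by apply: contraNF ki => /eqP ki; apply/eqP/val_inj.
- exists (fun i => (h i).1), (fun i => (h i).2); split=> [p w Ww|p q].
    by have [/(_ _ Ww)] := hP p.
  case: (ltngtP p q) => [pq|qp|<-].
  + by have [_ _ /(_ _ pq)] := hP q.
  + by have [_ /(_ _ qp)] := hP p.
  + by have [] := hP p.
Qed.

End SpanModulo.

(** * The canonical embedding into the bidual *)

Section Bidual.
Context (R : realType).

Lemma bidual_embedE (Y : normedModType R) (y : Y) (f : dual Y) :
  bidual_embed y f = f y :> R.
Proof. reflexivity. Qed.

Lemma bidual_embed_norm (Y : normedModType R) (y : Y) : `|y| <= `|bidual_embed y|.
Proof.
have [f f1 fy] := norming_functional y.
have := dual_ub (bidual_embed y) f; rewrite bidual_embedE fy normr_id => H.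
by rewrite (le_trans H)// ler_piMr.
Qed.

Lemma bidual_embed_linear (Y : normedModType R) (a : R) (x y : Y) :
  bidual_embed (a *: x + y) = a *: bidual_embed x + bidual_embed y.
Proof. by apply: dualP => f; rewrite dual_addE dual_scaleE !bidual_embedE dualD dualZ. Qed.

Lemma complete_approx (Y : completeNormedModType R) (u : nat -> Y) :
  (forall n m, `|u n - u m| <= n.+1%:R^-1 + m.+1%:R^-1) ->
  exists y : Y, u n @[n --> \oo] --> y.
Proof.
move=> uC; suff : cvg (u @ \oo) by move=> cu; exists (lim (u @ \oo)).
apply/cauchy_cvgP/cauchyP => e e0.
have [N _ NP] := near_infty_natSinv_lt (PosNum (divr_gt0 e0 (ltr0n R 2))).
exists (u N); exists N => // m /= Nm; rewrite -ball_normE /= (le_lt_trans (uC _ _))//.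
have h1 : N.+1%:R^-1 < e / 2 := NP _ (leqnn N).
by have h2 : m.+1%:R^-1 < e / 2 := NP m Nm; rewrite [ltRHS]splitr ltrD.
Qed.

(** The embedding is isometric and [Y] is complete. *)
Lemma bidual_embed_closed (Y : completeNormedModType R) :
  closed_subspace (range (@bidual_embed R Y)).
Proof.
split; first split.
- by exists 0 => //; apply: dualP => f; rewrite bidual_embedE dual0.
- move=> a _ _ [x _ <-] [y _ <-]; exists (a *: x + y) => //.
  by rewrite bidual_embed_linear.
move=> G GP.
have /choice[u uP] : forall n : nat, exists y : Y, `|G - bidual_embed y| < n.+1%:R^-1.
  move=> n; have [|_ [y _ <-]] := GP n.+1%:R^-1; [by rewrite invr_gt0|by exists y].
have [|y uy] := @complete_approx Y u.
  move=> n m; rewrite (le_trans (bidual_embed_norm _))//.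
  rewrite -scaleN1r addrC bidual_embed_linear scaleN1r.
  rewrite (_ : - bidual_embed (u m) + _ = (G - bidual_embed (u m)) - (G - bidual_embed (u n))); last first.
    by rewrite opprB (addrC G) addrACA subrr addr0.
  by rewrite (le_trans (ler_normB _ _))// addrC lerD// ltW.
exists y => //; apply: dualP => f; rewrite bidual_embedE.
have c1 : f (u n) @[n --> \oo] --> f y by apply: cvg_comp uy _; exact: dual_continuous.
have c2 : f (u n) @[n --> \oo] --> (G f : R).
  apply/cvgrPdist_le => /= e e0.
  have D0 : 0 < `|f| + 1 by rewrite ltr_wpDl.
  near=> n.
  have -> : G f - f (u n) = (G - bidual_embed (u n)) f by [].
  rewrite (le_trans (dual_ub _ _))//.
  rewrite (@le_trans _ _ (e / (`|f| + 1) * `|f|))//.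
    rewrite ler_wpM2r// ltW// (lt_trans (uP n))//.
    near: n; exact: (near_infty_natSinv_lt (PosNum (divr_gt0 e0 D0))).
  by rewrite mulrAC ler_pdivrMr//; apply: ler_wpM2l; [exact: ltW|rewrite lerDl].
by apply: (cvg_unique _ c1 c2); exact: Rhausdorff.
Unshelve. all: by end_near. Qed.

End Bidual.

(** * Arrays in nonquasireflexive spaces *)

Lemma helly_seq (R : realType) (E : normedModType R) (Lam : dual (dual E))
    (s : seq (dual E)) (r : R) : `|Lam| < r ->
  exists2 x : E, `|x| < r & forall phi, phi \in s -> phi x = Lam phi.
Proof.
move=> Lr; have [x xr xs] := helly (fun i => nth 0 s i) (size s) Lr.
by exists x => // phi /(nthP 0)[i ilt <-]; exact: xs.
Qed.

Section Array.
Context (R : realType) (Y : completeNormedModType R).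

(** Take [G], [L] biorthogonal in the bidual and its dual, with [L] null on [Y].
At stage [n], Helly's theorem applied to [L p] gives [w p] that annihilates the [d i] and the
vectors [S] of all earlier stages and satisfies [G q (w p) = delta_pq];
then, applied to [G p], it gives [S p] on which all functionals
[w] constructed so far have the value prescribed by [G p].  The norms are bounded by
those of [L p] and [G p].  The difference of two consecutive vectors [S p] is killed
by every earlier [w] (on which both agree with [G p]) and by every later one, and
the sums of these differences telescope. *)
Lemma nonquasireflexive_array (d : nat -> Y) : ~ quasireflexive Y ->
  exists (z : nat -> nat -> Y) (w : nat -> nat -> dual Y) (C B : nat -> R),
  [/\ forall p n q m, w p n (z q m) = ((p == q) && (n == m))%:R,
      forall p N, `|\sum_(n < N) z p n| <= C p,
      forall p n, `|w p n| <= B p &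
      forall p n i, (i <= n)%N -> w p n (d i) = 0].
Proof.
move=> nqr.
have [G [L [LJ LG]]] := biorthogonal_mod (bidual_embed_closed Y) nqr.
have {}LJ p y : L p (bidual_embed y) = 0 by apply: LJ; exists y.
pose P n (h : nat -> (nat -> dual Y) * (nat -> Y)) (x : (nat -> dual Y) * (nat -> Y)) :=
  (forall p, [/\ `|x.1 p| < `|L p| + 1,
     forall m q, (m < n)%N -> (q <= n)%N -> x.1 p ((h m).2 q) = 0,
     forall i, (i < n)%N -> x.1 p (d i) = 0 &
     forall q, (q <= n)%N -> G q (x.1 p) = (p == q)%:R]) /\
  (forall p, [/\ `|x.2 p| < `|G p| + 1,
     forall m q, (m < n)%N -> (q <= n)%N -> (h m).1 q (x.2 p) = G p ((h m).1 q) &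
     forall q, (q <= n)%N -> x.1 q (x.2 p) = G p (x.1 q)]).
have [|n h _|h hP] := @history_choice _ P ((fun=> 0), (fun=> 0)).
- move=> n h h' x hh [Pw PS]; split=> p.
    have [a1 a2 a3 a4] := Pw p; split=> // m q mn qn.
    by rewrite -hh//; exact: a2.
  have [a1 a2 a3] := PS p; split=> // m q mn qn.
  by rewrite -hh//; exact: a2.
- have /choice[w wP] p : exists w : dual Y, [/\ `|w| < `|L p| + 1,
     forall m q, (m < n)%N -> (q <= n)%N -> w ((h m).2 q) = 0,
     forall i, (i < n)%N -> w (d i) = 0 &
     forall q, (q <= n)%N -> G q w = (p == q)%:R].
    have Lp : `|L p| < `|L p| + 1 by rewrite ltrDl.
    have [w w1 wE] := helly_seq (
       [seq bidual_embed ((h m).2 q) | m <- iota 0 n, q <- iota 0 n.+1] ++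
       [seq bidual_embed (d i) | i <- iota 0 n] ++
       [seq G q | q <- iota 0 n.+1]) Lp.
    exists w; split=> // [m q mn qn|i lin|q qn].
    + rewrite -[LHS]/(bidual_embed ((h m).2 q) w : R) wE ?LJ// mem_cat.
      apply/orP; left; apply/allpairsP; exists (m, q); split; rewrite ?mem_iota//.
    + rewrite -[LHS]/(bidual_embed (d i) w : R) wE ?LJ// !mem_cat.
      by apply/orP; right; apply/orP; left; apply: map_f; rewrite mem_iota.
    + rewrite wE ?LG// !mem_cat.
      by apply/orP; right; apply/orP; right; apply: map_f; rewrite mem_iota.
  have /choice[S SP] p : exists S : Y, [/\ `|S| < `|G p| + 1,
     forall m q, (m < n)%N -> (q <= n)%N -> (h m).1 q S = G p ((h m).1 q) &
     forall q, (q <= n)%N -> w q S = G p (w q)].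
    have Gp : `|G p| < `|G p| + 1 by rewrite ltrDl.
    have [S S1 SE] := helly_seq (
       [seq (h m).1 q | m <- iota 0 n, q <- iota 0 n.+1] ++
       [seq w q | q <- iota 0 n.+1]) Gp.
    exists S; split=> // [m q mn qn|q qn]; apply: SE; rewrite mem_cat.
    + apply/orP; left; apply/allpairsP; exists (m, q); split; rewrite ?mem_iota//.
    + by apply/orP; right; apply: map_f; rewrite mem_iota.
  by exists (w, S).
pose S p n := (h n).2 p; pose w p n := (h n).1 p.
exists (fun p n => S p (p + n).+1 - S p (p + n)%N), (fun p n => w p (p + n).+1),
  (fun p => (`|G p| + 1) + (`|G p| + 1)), (fun p => `|L p| + 1); split.
- move=> p n q m; rewrite dualB.
  case: (ltngtP (p + n) (q + m)) => [lt|gt|eq].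
  + have pS : (p <= q + m)%N by rewrite ltnW// (leq_ltn_trans (leq_addr n p)).
    have E1 : w p (p + n).+1 (S q (q + m).+1) = G q (w p (p + n).+1).
      by have [_ /(_ q)[_ + _]] := hP (q + m).+1; apply=> //; exact: ltnW.
    have -> : w p (p + n).+1 (S q (q + m)%N) = G q (w p (p + n).+1).
      move: lt; rewrite leq_eqVlt => /predU1P[<-|lt].
        have [_ /(_ q)[_ _]] := hP (p + n).+1; apply.
        by rewrite ltnW// ltnS leq_addr.
      by have [_ /(_ q)[_ + _]] := hP (q + m)%N; apply.
    rewrite E1 subrr; case: eqP => // pq; case: eqP => // nm.
    by move: lt; rewrite pq nm ltnn.
  + have qS : (q <= (p + n).+1)%N.
      by rewrite (leq_trans (leq_addr m q))// ltnW// ltnS ltnW.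
    have [/(_ p)[_ H _ _] _] := hP (p + n).+1.
    rewrite H// H//; last by rewrite ltnS ltnW.
    rewrite subrr; case: eqP => // pq; case: eqP => // nm.
    by move: gt; rewrite pq nm ltnn.
  + have pS : (p <= (p + n).+1)%N by rewrite ltnW// ltnS leq_addr.
    have qS : (q <= (p + n).+1)%N by rewrite eq ltnW// ltnS leq_addr.
    have [/(_ p)[_ H _ H2] /(_ q)[_ _ H3]] := hP (p + n).+1.
    rewrite -eq H3// H// subr0 H2//; case: eqP => //= pq; case: eqP => // nm.
    by exfalso; apply: nm; move: eq; rewrite pq => /addnI.
- move=> p N.
  have -> : \sum_(n < N) (S p (p + n).+1 - S p (p + n)%N) = S p (p + N)%N - S p p.
    elim: N => [|N IH]; first by rewrite big_ord0 addn0 subrr.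
    by rewrite big_ord_recr /= IH addrC addrA subrK addnS.
  rewrite (le_trans (ler_normB _ _))//.
  have [_ /(_ p)[+ _ _]] := hP (p + N)%N; have [_ /(_ p)[+ _ _]] := hP p.
  by move=> a b; rewrite lerD// ltW.
- by move=> p n; have [/(_ p)[+ _ _ _] _] := hP (p + n).+1; exact: ltW.
- move=> p n i lin; have [/(_ p)[_ _ H _] _] := hP (p + n).+1.
  by apply: H; rewrite ltnS (leq_trans lin) ?leq_addl.
Qed.

End Array.

(** * Weak* convergence *)

Section WeakStar.
Context (R : realType).

(** Pointwise generalized limits: a form of the Banach-Alaoglu theorem. *)
Lemma wstar_limit_exists (Y : normedModType R) (L : (nat -> R) -> R) (y : nat -> dual Y) (K : R) :
  generalized_limit L -> (forall n, `|y n| <= K) ->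
  exists2 l : dual Y, `|l| <= K & forall t, l t = L (fun n => y n t).
Proof.
move=> [Llin Lb _] yK.
have yb t n : `|y n t| <= K * `|t| by rewrite (le_trans (dual_ub _ _))// ler_wpM2r.
have K0 : 0 <= K by rewrite (le_trans _ (yK 0))//.
have [a u v|t|l lE lK] := dual_of_bound (f := fun t => L (fun n => y n t)) (K := K) _ _ K0.
- rewrite -Llin; [|by exists (K * `|u|)|by exists (K * `|v|)].
  by congr L; apply/funext => n; rewrite dualD dualZ.
- exact: Lb.
- by exists l.
Qed.

Lemma wstar_cvg_dense (X : normedModType R) (x : nat -> X) (u : nat -> dual X) (f : dual X) (K : R) :
  (forall v e, 0 < e -> exists i, `|v - x i| < e) ->
  (forall n, `|u n| <= K) ->
  (forall i, (u n (x i) : R) @[n --> \oo] --> (f (x i) : R)) ->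
  wstar_cvg u f.
Proof.
move=> xd uK ux v; apply/cvgrPdist_le => /= e e0.
have K0 : 0 <= K by rewrite (le_trans _ (uK 0))//.
pose D := `|f| + K + 1; have D0 : 0 < D by rewrite ltr_wpDl// addr_ge0.
have [i xi] := xd v _ (divr_gt0 (divr_gt0 e0 (ltr0n R 2)) D0).
have /cvgrPdist_le/(_ _ (divr_gt0 e0 (ltr0n R 2)))/= := ux i.
apply: filterS => n un.
have -> : f v - u n v = f (v - x i) + (f (x i) - u n (x i)) - u n (v - x i).
  by rewrite !dualB; ring.
have h1 := dual_ub f (v - x i); have h2 := dual_ub (u n) (v - x i).
have h3 : `|u n| * `|v - x i| <= K * `|v - x i| by rewrite ler_wpM2r.
have h4 : `|v - x i| * D <= e / 2 by rewrite -ler_pdivlMr// ltW.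
have h5 := normr_ge0 (v - x i).
rewrite (le_trans (ler_normB _ _))// (le_trans (lerD (ler_normD _ _) (lexx _)))//.
move: h4; rewrite /D => h4; lra.
Qed.

Lemma wstar_cvg_bounded (X : completeNormedModType R) (u : nat -> dual X) (f : dual X) :
  wstar_cvg u f -> exists K, forall n, `|u n| <= K.
Proof.
move=> uf.
have [|x|M MP] := @Banach_Steinhauss R X R^o [set g | exists n, g = u n :> (X -> R^o)] _ _ 1.
- move=> _ [n ->]; split; last by move=> a x y; rewrite dualD dualZ.
  by move=> r; exists (`|u n| * r) => x xr; rewrite (le_trans (dual_ub _ _))// ler_wpM2l.
- have /cvg_seq_bounded/= : cvgn (fun n => u n x : R^o).
    by apply/cvg_ex; exists (f x); exact: uf.
  move=> [M [Mr /(_ (M + 1))]]; rewrite ltrDl ltr01 => /(_ isT) uM.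
  by exists (M + 1) => _ [n ->]; exact: uM.
exists (`|M|) => n; apply: dual_norm_le => // x.
have [->|xn] := eqVneq x 0; first by rewrite dual0 !normr0 mulr0.
have xp : 0 < `|x| by rewrite normr_gt0.
have := MP (u n) (ex_intro _ n erefl) (`|x|^-1 *: x).
rewrite normrZ normfV normr_id mulVf ?gt_eqF// lexx => /(_ isT).
rewrite dualZ normrM normfV normr_id mulrC ler_pdivrMr// => H.
by rewrite (le_trans H)// ler_wpM2r// ler_norm.
Qed.

Lemma separable_sequence (X : normedModType R) : separable_space X ->
  exists x : nat -> X, forall v e, 0 < e -> exists i, `|v - x i| < e.
Proof.
move=> [D [/countable_injP[f finj] dD]].
exists (fun i => get [set a | D a /\ f a = i]) => v e e0.
have [||a [/= va Da]] := dD (ball v e).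
- by exists v; exact: ballxx.
- exact: ball_open.
exists (f a).
have [Db fb] : [set b | D b /\ f b = f a] (get [set b | D b /\ f b = f a]).
  by apply: getPex; exists a.
rewrite (_ : get _ = a); first by move: va; rewrite -ball_normE.
by apply: finj => //; rewrite inE.
Qed.

(** Weak* density is achieved by choosing, for each size [n], bound [B] and integer vector [q],
one functional of norm at most [B] whose values at the first [n] points of a
dense sequence are [q / (n+1)] up to [1 / (n+1)], if there is any.  Independence modulo [W] is then forced
one functional after the other by perturbations of norm at most [1 / (n+1)],
which do not disturb the convergence. *)
Lemma independent_wstar_dense (X : normedModType R) (W : set (dual X)) :
  separable_space X -> closed_subspace W -> ~ finite_codim W ->
  exists f : nat -> dual X,
    (forall k, ~ span_mod W f k (f k)) /\
    forall g, exists kappa : nat -> nat, wstar_cvg (fun n => f (kappa n)) g.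
Proof.
move=> sX cW nW.
have [x xd] := separable_sequence sX.
pose good (c : nat * nat * seq int) (f : dual X) :=
  `|f| <= c.1.2%:R /\ forall i, (i < c.1.1)%N ->
      `|f (x i) * c.1.1.+1%:R - (nth 0 c.2 i)%:~R| <= 1.
have /choice[F FP] (c : nat * nat * seq int) : exists f, (exists f', good c f') -> good c f.
  by have [[f Hf]|nf] := pselect (exists f', good c f'); [exists f|exists 0].
pose g k := if unpickle k is Some c then F c else 0.
pose eta k : R := if @unpickle (nat * nat * seq int)%type k is Some c then c.1.1.+1%:R^-1 else 1.
have eta0 k : 0 < eta k by rewrite /eta; case: unpickle => // c; rewrite invr_gt0.
have [|n h _|f fP] := @history_choice _ (fun n h z => `|z - g n| <= eta n /\ ~ span_mod W h n z) 0.
- move=> n h h' z hh [zg nz]; split=> // Wz; apply: nz; apply: span_mod_ext Wz.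
  by move=> i lin; rewrite hh.
- have [Wg|nWg] := pselect (span_mod W h n (g n)); last first.
    by exists (g n); split=> //; rewrite subrr normr0 ltW.
  have [v nv] := span_mod_proper h n nW.
  have cS := span_mod_closed h n cW.
  have v0 : 0 < `|v| + 1 by rewrite ltr_wpDl.
  have c0 : eta n / (`|v| + 1) != 0 by rewrite gt_eqF// divr_gt0.
  exists (g n + (eta n / (`|v| + 1)) *: v); split.
    rewrite addrC addKr normrZ gtr0_norm ?divr_gt0//.
    by rewrite mulrAC ler_pdivrMr//; apply: ler_wpM2l; [exact: ltW|rewrite lerDl].
  move=> H; apply: nv; case: cS => sS _.
  have := subspaceZ (eta n / (`|v| + 1))^-1 sS (subspaceD sS H (subspaceN sS Wg)).
  by rewrite addrAC subrr add0r scalerA mulVf// scale1r.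
exists f; split=> [k|G]; first by have [] := fP k.
(* The functional coded by the bound of [G] and its rounded values at the first
   [n] points agrees with [G] there up to [2 / (n+1)]. *)
pose B := (Num.truncn `|G|).+1.
pose q n := [seq Num.floor (G (x i) * n.+1%:R : R) | i <- iota 0 n].
pose kappa n := pickle ((n, B, q n) : (nat * nat * seq int)%type).
exists kappa.
have GB : `|G| <= B%:R by rewrite ltW// truncnS_gt.
have Ggood n : good (n, B, q n) G.
  split=> //= i lin.
  rewrite (nth_map 0%N) ?size_iota// nth_iota// add0n.
  have := floor_le (G (x i) * n.+1%:R); have := floorD1_gt (G (x i) * n.+1%:R).
  by rewrite intrD => h1 h2; rewrite ger0_norm ?subr_ge0// lerBlDr addrC ltW.
have Fgood n : good (n, B, q n) (F (n, B, q n)) by apply: FP; exists G.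
have fF n : `|f (kappa n) - F (n, B, q n)| <= n.+1%:R^-1.
  have [+ _] := fP (kappa n); rewrite /g /eta /kappa pickleK /=; exact.
apply: (wstar_cvg_dense (x := x) (K := B%:R + 1)) => // [n|i].
  rewrite -(subrK (F (n, B, q n)) (f (kappa n))) addrC (le_trans (ler_normD _ _))// lerD//.
    by have [] := Fgood n.
  by rewrite (le_trans (fF n))// invf_le1// ler1n.
apply/cvgrPdist_le => /= e e0.
pose C := 2 + `|x i|; have C0 : 0 < C by rewrite ltr_pwDl.
near=> n.
have lin : (i < n)%N by near: n; exists i.+1.
have [_ /(_ _ lin)/= FG] := Fgood n.
have [_ /(_ i lin)/= GG] := Ggood n.
have n0 : 0 < n.+1%:R :> R by [].
have H1 : `|G (x i) - F (n, B, q n) (x i)| <= 2 * n.+1%:R^-1.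
  rewrite ler_pdivlMr// -{1}(gtr0_norm n0) -normrM mulrBl.
  move: GG FG; set a := G (x i) * _; set b := F _ _ * _; set c := _%:~R => ac bc.
  by rewrite -(subrKA c) (le_trans (ler_normD _ _))// [2]/(1 + 1) lerD// distrC.
have H2 : `|F (n, B, q n) (x i) - f (kappa n) (x i)| <= n.+1%:R^-1 * `|x i|.
  rewrite distrC -dual_subE (le_trans (dual_ub _ _))// ler_wpM2r//.
rewrite -(subrKA (F (n, B, q n) (x i))) (le_trans (ler_normD _ _))//.
rewrite (le_trans (lerD H1 H2))// [2 * _]mulrC -mulrDr.
have : n.+1%:R^-1 < e / C.
  near: n; exact: (near_infty_natSinv_lt (PosNum (divr_gt0 e0 C0))).
by rewrite ltr_pdivlMr// => /ltW.
Unshelve. all: by end_near. Qed.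

End WeakStar.

(** * Kernels in infinite-dimensional spaces *)

Section FiniteDimension.
Context (R : realType).

Lemma finite_dim_kernel (X : normedModType R) (L : set X) (f : dual X) :
  is_subspace L -> finite_dim (L `&` [set x | f x = 0]) -> finite_dim L.
Proof.
move=> [L0 Ll] [n [e eP]].
have [[x0 [Lx0 fx0]]|nx0] := pselect (exists x, L x /\ f x <> 0); last first.
  exists n, e => x Lx; apply: eP; split=> //=.
  by apply: contrapT => fx; apply: nx0; exists x.
exists n.+1, (fun i : 'I_n.+1 => if unlift ord0 i is Some j then e j else x0) => x Lx.
have [|a ax] := eP (- (f x / f x0) *: x0 + x).
  split; first exact: Ll.
  by rewrite /= dualD dualZ mulNr divfK ?addNr//; apply/eqP.
exists (fun i : 'I_n.+1 => if unlift ord0 i is Some j then a j else f x / f x0).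
rewrite big_ord_recl unlift_none -[LHS](addKr (- (f x / f x0) *: x0)) ax scaleNr opprK.
by congr (_ + _); apply: eq_bigr => i _; rewrite liftK.
Qed.

Lemma subspace_kernels (X : normedModType R) (L : set X) (f : nat -> dual X) n :
  is_subspace L -> is_subspace (L `&` [set x | forall i, (i < n)%N -> f i x = 0]).
Proof.
move=> [L0 Ll]; split; first by split=> // i _; rewrite dual0.
move=> a u v [Lu fu] [Lv fv]; split; first exact: Ll.
by move=> i lin; rewrite dualD dualZ fu// fv// mulr0 addr0.
Qed.

Lemma infinite_dim_kernels (X : normedModType R) (L : set X) (f : nat -> dual X) n :
  is_subspace L -> ~ finite_dim L ->
  ~ finite_dim (L `&` [set x | forall i, (i < n)%N -> f i x = 0]).
Proof.
move=> sL nL; elim: n => [|n IH].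
  by rewrite (_ : _ `&` _ = L)//; apply/seteqP; split=> [x []|x Lx].
move=> fd; apply: IH; apply: (@finite_dim_kernel _ _ (f n)); first exact: subspace_kernels.
rewrite (_ : _ `&` _ `&` _ = L `&` [set x | forall i, (i < n.+1)%N -> f i x = 0])//.
apply/seteqP; split=> x.
  by move=> [[Lx fx] fn]; split=> // i; rewrite ltnS leq_eqVlt => /predU1P[->|/fx].
by move=> [Lx fx]; split; [split=> // i lin|]; apply: fx => //; rewrite ltnS ltnW.
Qed.

End FiniteDimension.

(** * The adjoint of a surjective strictly singular operator *)

Section Adjoint.
Context (R : realType) (X Y : completeNormedModType R) (T : {linear X -> Y}).
Hypothesis cT : continuous T.

Lemma operator_bound : exists2 K, 0 <= K & forall x, `|T x| <= K * `|x|.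
Proof.
have /linear_boundedP := continuous_linear_bounded 0 (@cT 0).
move=> [r [_ /(_ (`|r| + 1))]]; rewrite (le_lt_trans (ler_norm _)) ?ltrDl//.
by move=> /(_ isT) Tr; exists (`|r| + 1) => //; rewrite addr_ge0.
Qed.

Lemma adjoint_subproof (y : dual Y) : (fun x => y (T x)) \in @dual_pred R X.
Proof.
apply/dual_predP; split; first by move=> a u v; rewrite linearP dualD dualZ.
by move=> x; apply: continuous_comp; [exact: cT|exact: dual_continuous].
Qed.

Definition adjoint (y : dual Y) : dual X := Dual (adjoint_subproof y).

Lemma adjointE y x : adjoint y x = y (T x) :> R. Proof. by []. Qed.

Lemma adjoint_linear (a : R) y y' : adjoint (a *: y + y') = a *: adjoint y + adjoint y'.
Proof. by apply: dualP => x. Qed.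

(** A lower bound for [T] on [L] would make the inverse of [T] Lipschitz on [T @` L]. *)
Lemma strictly_singular_small (L : set X) (e : R) : strictly_singular T ->
  is_subspace L -> ~ finite_dim L -> 0 < e ->
  exists x, L x /\ `|T x| < e * `|x|.
Proof.
move=> ssT sL nL e0; apply: contrapT => H; apply: (ssT L sL nL).
have lo x : L x -> e * `|x| <= `|T x|.
  by move=> Lx; rewrite leNgt; apply/negP => ?; apply: H; exists x.
split; first exact: continuous_subspaceT.
have /choice[S SP] (y : Y) : exists x, (exists x', L x' /\ T x' = y) -> L x /\ T x = y.
  by have [[x Hx]|nx] := pselect (exists x', L x' /\ T x' = y); [exists x|exists 0].
have SK x : L x -> S (T x) = x.
  move=> Lx; have [|LS TS] := SP (T x); first by exists x.
  apply/eqP; rewrite -subr_eq0 -normr_le0 -(pmulr_rle0 _ e0).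
  have /lo : L (S (T x) - x) by exact: subspaceD (subspaceN sL Lx).
  by rewrite linearB/= TS subrr normr0.
exists S; split=> //; apply/subspace_continuousP => _ [x Lx <-].
apply/cvgrPdist_lt => /= d d0. rewrite /from_subspace SK// near_withinE.
near=> y => -[x' Lx' yE]; rewrite -yE SK// -(ltr_pM2l e0).
rewrite (le_lt_trans (lo _ _))//; first exact: subspaceD (subspaceN sL Lx').
rewrite linearB/= yE; near: y.
by apply: cvgr_dist_lt; rewrite ?mulr_gt0//; exact: cvg_id.
Unshelve. all: by end_near. Qed.

Hypothesis sT : range T = [set: Y].

(** By surjectivity of [T], the functionals [y] with [|T^* y| <= 1] are pointwise bounded on
[Y], so the uniform boundedness principle applies to them. *)
Lemma adjoint_lower_bound : exists2 tau, 0 < tau & forall y, tau * `|y| <= `|adjoint y|.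
Proof.
have [|y|M MP] := @Banach_Steinhauss R Y R^o
    [set g | exists y : dual Y, `|adjoint y| <= 1 /\ g = y :> (Y -> R^o)] _ _ 1.
- move=> _ [y [_ ->]]; split; last by move=> a u v; rewrite dualD dualZ.
  by move=> r; exists (`|y| * r) => x xr; rewrite (le_trans (dual_ub _ _))// ler_wpM2l.
- have : range T y by rewrite sT.
  move=> [x _ <-]; exists `|x| => _ [f [f1 ->]].
  by rewrite -adjointE (le_trans (dual_ub _ _))// ler_piMl.
have M0 : 0 < `|M| + 1 by rewrite ltr_wpDl.
have yM (y : dual Y) : `|adjoint y| <= 1 -> `|y| <= `|M| + 1.
  move=> y1; apply: dual_norm_le => [|t]; first exact: ltW.
  have [->|tn] := eqVneq t 0; first by rewrite dual0 !normr0 mulr0.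
  have tp : 0 < `|t| by rewrite normr_gt0.
  have := MP y (ex_intro _ y (conj y1 erefl)) (`|t|^-1 *: t).
  rewrite normrZ normfV normr_id mulVf ?gt_eqF// lexx => /(_ isT).
  rewrite dualZ normrM normfV normr_id mulrC ler_pdivrMr// => H.
  by rewrite (le_trans H)// ler_wpM2r// (le_trans (ler_norm _))// lerDl.
exists (`|M| + 1)^-1; first by rewrite invr_gt0.
move=> y; rewrite mulrC ler_pdivrMr//; apply/ler_addgt0Pr => e e0.
pose s := `|adjoint y| + e / (`|M| + 1).
have s0 : 0 < s by rewrite ltr_wpDl// divr_gt0.
have adjZ a u : adjoint (a *: u) = a *: adjoint u.
  by apply: dualP => x.
have := yM (s^-1 *: y); rewrite adjZ !normrZ normfV gtr0_norm//.
rewrite mulrC ler_pdivrMr// mul1r lerDl ltW ?divr_gt0// => /(_ isT).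
by rewrite mulrC ler_pdivrMr// /s mulrDr [_ * (e / _)]mulrC divfK ?gt_eqF// mulrC.
Qed.

(** If the [T^* y_n] converge in norm, the [y_n] are bounded, and any of their weak* cluster points is mapped to the limit. *)
Lemma adjoint_range_closed : closed_subspace (range adjoint).
Proof.
have [tau tau0 tauP] := adjoint_lower_bound.
split; first split.
- by exists 0 => //; apply: dualP => x.
- by move=> a _ _ [u _ <-] [v _ <-]; exists (a *: u + v) => //; rewrite adjoint_linear.
move=> f fP.
have /choice[y yP] (n : nat) : exists y, `|f - adjoint y| < n.+1%:R^-1.
  by have [|_ [y _ <-]] := fP n.+1%:R^-1; [rewrite invr_gt0|exists y].
have yK n : `|y n| <= (`|f| + 1) / tau.
  rewrite ler_pdivlMr// mulrC (le_trans (tauP _))//.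
  rewrite -[adjoint _](subKr f) (le_trans (ler_normB _ _))// lerD2l.
  by rewrite (le_trans (ltW (yP n)))// invf_le1// ler1n.
have [L LP] := generalized_limit_exists R.
have [l _ lE] := wstar_limit_exists LP yK.
exists l => //; apply: dualP => x; rewrite adjointE lE.
have [_ _ Llim] := LP; apply: Llim.
have D0 : 0 < `|x| + 1 by rewrite ltr_wpDl.
apply/cvgrPdist_le => /= e e0; near=> n.
rewrite -adjointE -dual_subE (le_trans (dual_ub _ _))//.
apply: (@le_trans _ _ (e / (`|x| + 1) * `|x|)).
  rewrite ler_wpM2r// ltW// (lt_trans (yP n))//.
  near: n; exact: (near_infty_natSinv_lt (PosNum (divr_gt0 e0 D0))).
by rewrite mulrAC ler_pdivrMr//; apply: ler_wpM2l; [exact: ltW|rewrite lerDl].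
Unshelve. all: by end_near. Qed.

(** Here the [e i] may be dependent modulo the range; those that are redundant
are given the coefficient 0. *)
Lemma adjoint_span_bounded e n : exists2 c, 0 < c &
  forall f, span_mod (range adjoint) e n f ->
    exists (a : nat -> R) y, f = \sum_(i < n) a i *: e i + adjoint y /\ c * `|y| <= `|f|.
Proof.
elim: n => [|n [c c0 IH]].
  have [tau tau0 tauP] := adjoint_lower_bound; exists tau => // f.
  by rewrite span_mod0 => -[y _ <-]; exists (fun=> 0), y; rewrite big_ord0 add0r.
have cS := span_mod_closed e n adjoint_range_closed.
have [en|nen] := pselect (span_mod (range adjoint) e n (e n)).
  exists c => // f; rewrite span_modS => -[g [t [Sg ->]]].
  have /IH[a [y [E yc]]] : span_mod (range adjoint) e n (g + t *: e n).
    by apply: subspaceD => //; [case: cS|apply: subspaceZ => //; case: cS].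
  exists (fun i => if (i == n :> nat) then 0 else a i), y; split=> //.
  rewrite E big_ord_recr /= eqxx scale0r addr0; congr (_ + _).
  by apply: eq_bigr => i _; rewrite ltn_eqF.
have [d d0 dP] := closed_subspace_decompose cS nen.
exists (c * d); first exact: mulr_gt0.
move=> f; rewrite span_modS => -[g [t [Sg ->]]].
have [a [y [E yc]]] := IH g Sg; have [_ gd] := dP g t Sg.
exists (fun i => if (i == n :> nat) then t else a i), y; split; last first.
  by rewrite mulrAC (le_trans _ gd)// mulrC ler_wpM2l// ltW.
rewrite E big_ord_recr /= eqxx addrAC; congr (_ + _ + _).
by apply: eq_bigr => i _; rewrite ltn_eqF.
Qed.

(** If the range and finitely many [e i] spanned everything, a norming functional
of a vector [x] killed by the [e i] would be [T^* y] at [x], with a uniform bound on [y];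
so [T] would be bounded below on the common kernel of the [e i]. *)
Lemma adjoint_range_infinite_codim : strictly_singular T -> ~ finite_dim [set: X] ->
  ~ finite_codim (range adjoint).
Proof.
move=> ssT nX [n [e eP]].
pose e' k := if insub k is Some i then e i else 0.
have [c c0 cP] := adjoint_span_bounded e' n.
have sX : is_subspace [set: X] by [].
have nL := @infinite_dim_kernels _ _ _ e' n sX nX.
have [x [[_ ex] Tx]] := strictly_singular_small ssT (subspace_kernels e' n sX) nL c0.
have [f f1 fx] := norming_functional x.
have [a [w [Ww fE]]] := eP f.
have [|b [y [E yc]]] := cP f.
  exists (fun k => if insub k is Some i then a i else 0), w; split=> //.
  rewrite fE; congr (_ + _); apply: eq_bigr => i _.
  by rewrite /e' insubT//= => il; congr (a _ *: e _); exact: val_inj.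
have fxE : f x = y (T x).
  rewrite E dual_addE adjointE (dual_sumE _ (fun i => b i *: e' i)) big1 ?add0r// => i _.
  by rewrite dual_scaleE ex ?mulr0.
have H1 := dual_ub y (T x).
have yc1 : c * `|y| <= 1 by rewrite (le_trans yc).
have : `|x| <= `|y| * `|T x| by rewrite (le_trans _ H1)// -fxE fx normr_id.
have y0 := normr_ge0 y; have T0 := normr_ge0 (T x); have x0 := normr_ge0 x.
have xp : 0 < `|x|.
  by rewrite lt_def x0 andbT; apply/eqP => xE; move: Tx; rewrite xE mulr0 ltNge T0.
have : `|y| * `|T x| <= `|y| * (c * `|x|) by rewrite ler_wpM2l// ltW.
have [->|yn] := eqVneq `|y| 0; first by rewrite !mul0r; lra.
have yp : 0 < `|y| by rewrite lt_def yn.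
have : `|y| * `|T x| < `|y| * (c * `|x|) by rewrite ltr_pM2l.
nra.
Qed.

Lemma independent_lower_bound (f : nat -> dual X) :
  (forall k, ~ span_mod (range adjoint) f k (f k)) ->
  exists c : nat -> R, (forall n, 0 < c n) /\ forall n (a : nat -> R) (y : dual Y),
    let g := \sum_(i < n) a i *: f i + adjoint y in
    c n * `|y| <= `|g| /\ forall i, (i < n)%N -> c n * `|a i| <= `|g|.
Proof.
move=> fP.
suff /choice[c cP] n : exists c, 0 < c /\ forall (a : nat -> R) (y : dual Y),
    let g := \sum_(i < n) a i *: f i + adjoint y in
    c * `|y| <= `|g| /\ forall i, (i < n)%N -> c * `|a i| <= `|g|.
  by exists c; split=> n; have [] := cP n.
elim: n => [|n [c [c0 IH]]].
  have [tau tau0 tauP] := adjoint_lower_bound; exists tau; split=> // a y.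
  by rewrite /= big_ord0 add0r.
have cS := span_mod_closed f n adjoint_range_closed.
have [d d0 dP] := closed_subspace_decompose cS (fP n).
exists (Num.min (c * d) d); split; first by rewrite lt_min d0 mulr_gt0.
move=> a y /=; rewrite big_ord_recr /= addrAC.
set g := \sum_(i < n) _ + _.
have Sg : span_mod (range adjoint) f n g by exists a, (adjoint y).
have [ad gd] := dP g (a n) Sg; have [/= yc ac] := IH a y.
have le1 (t : R) : 0 <= t -> c * t <= `|g| -> Num.min (c * d) d * t <= `|g + a n *: f n|.
  move=> t0 ct; rewrite (le_trans _ gd)//.
  rewrite (@le_trans _ _ (c * d * t))//; first by rewrite ler_wpM2r// ge_min lexx.
  by rewrite mulrAC mulrC ler_wpM2l// ltW.
split; first exact: le1.
move=> i; rewrite ltnS leq_eqVlt => /predU1P[->|lin].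
  by rewrite (le_trans _ ad)// ler_wpM2r// ge_min lexx orbT.
by apply: le1 => //; exact: ac.
Qed.

End Adjoint.

(** * Initial segments of ordinals *)

Section Ordinals.
Implicit Types A B : Ord.

Lemma ord_irrefl A (x : A) : ~ ord_rel x x.
Proof.
by elim/(well_founded_ind (@ord_wf A)): x => x IH xx; exact: (IH x).
Qed.

Section Segment.
Context (A : Ord) (i : A).

Definition segment_rel (x y : {j : A | ord_rel j i}) := ord_rel (sval x) (sval y).

Lemma segment_trans x y z : segment_rel x y -> segment_rel y z -> segment_rel x z.
Proof. exact: ord_trans. Qed.

Lemma segment_trichotomy x y : segment_rel x y \/ x = y \/ segment_rel y x.
Proof.
case: (ord_trichotomy (sval x) (sval y)) => [|[xy|]]; [by left| |by right; right].
by right; left; case: x y xy => [x xi] [y yi] /= xy; apply: eq_exist.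
Qed.

Lemma segment_wf : well_founded segment_rel.
Proof.
have H (a : A) : forall x : {j : A | ord_rel j i}, sval x = a -> Acc segment_rel x.
  elim/(well_founded_ind (@ord_wf A)): a => a IH x xa; apply: Acc_intro => y yx.
  by apply: (IH (sval y)) => //; rewrite -xa.
by move=> x; exact: (H (sval x)).
Qed.

Definition segment : Ord := MkOrd segment_trans segment_trichotomy segment_wf.

End Segment.

(** [B] represents the ordinal of the position [i] in [A]. *)
Definition is_segment B A (i : A) := exists f : B -> A,
  (forall x y, ord_rel x y -> ord_rel (f x) (f y)) /\ range f = [set j | ord_rel j i].

Lemma segment_lt A (i : A) : ord_lt (segment i) A.
Proof.
exists sval, i; split=> //; apply/seteqP; split=> [_ [[x xi] _ <-]//|x xi].
by exists (exist _ x xi).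
Qed.

Lemma segment_lt_segment A (j i : A) : ord_rel j i -> ord_lt (segment j) (segment i).
Proof.
move=> ji; exists (fun x : segment j => exist (fun k => ord_rel k i) (sval x) (ord_trans (svalP x) ji)).
exists (exist _ j ji); split=> //; apply/seteqP; split=> [_ [[x xj] _ <-]//|[x xi] xj].
by exists (exist _ x xj) => //; exact: eq_exist.
Qed.

Lemma ord_lt_succ A : ord_lt A (ord_succ A).
Proof.
exists some, None; split=> //; apply/seteqP; split=> [_ [x _ <-]//|[x|] //= _].
by exists x.
Qed.

Lemma is_segment_lt B B' A (j : A) : is_segment B j -> ord_lt B' B ->
  exists2 j', ord_rel j' j & is_segment B' j'.
Proof.
move=> [f [fmono frange]] [g [i [gmono grange]]].
exists (f i).
  by have : range f (f i) by [exists i]; rewrite frange.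
exists (f \o g); split=> [x y xy|]; first exact/fmono/gmono.
apply/seteqP; split=> [_ [x _ <-]|k /= kj].
  by apply: fmono; have : range g (g x) by [exists x]; rewrite grange.
have : range f k.
  rewrite frange; apply: ord_trans kj _.
  by have : range f (f i) by [exists i]; rewrite frange.
move=> [y _ yk]; subst k.
have : range g y.
  rewrite grange /=; have [//|[yi|iy]] := ord_trichotomy y i.
    by subst y; exfalso; exact: ord_irrefl kj.
  by exfalso; exact: ord_irrefl (ord_trans kj (fmono _ _ iy)).
by move=> [x _ <-]; exists x.
Qed.

(** Running maxima of an enumeration of [P].  If [P] has a greatest element, the
sequence is eventually constant, so that successor and limit
ordinals are treated alike. *)
Lemma cofinal_sequence A (P : A -> Prop) : countable [set: A] -> (exists i, P i) ->
  exists e : nat -> A, (forall n, P (e n)) /\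
    forall j, P j -> exists N, forall n, (N <= n)%N -> ~ ord_rel (e n) j.
Proof.
move=> /countable_injP[f finj] [i0 Pi0].
have /choice[x xP] (n : nat) : exists a, P a /\ forall b, P b -> f b = n -> a = b.
  have [[b [Pb fb]]|nb] := pselect (exists b, P b /\ f b = n); last first.
    by exists i0; split=> // b Pb fb; exfalso; apply: nb; exists b.
  by exists b; split=> // b' _ fb'; apply: finj; rewrite ?inE// fb fb'.
pose step (a : A) (b : A) := if pselect (ord_rel a b) then b else a.
pose e := fix e n := if n is m.+1 then step (e m) (x m.+1) else x 0%N.
have eP n i : (i <= n)%N -> ~ ord_rel (e n) (x i).
  elim: n i => [|n IH] i; first by rewrite leqn0 => /eqP->; exact: ord_irrefl.
  rewrite /= /step; case: pselect => [lt|nlt]; rewrite leq_eqVlt => /predU1P[->//|].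
  - exact: ord_irrefl.
  - by rewrite ltnS => lin xx; apply: (IH i lin); exact: ord_trans lt xx.
  - by rewrite ltnS; exact: IH.
exists e; split=> [|j Pj].
  elim=> [|n IH] /=; first by have [] := xP 0%N.
  by rewrite /step; case: pselect => ? /=; [have [] := xP n.+1|].
exists (f j) => n fn; have [_ /(_ j Pj erefl) <-] := xP (f j); exact: eP.
Qed.

End Ordinals.

(** * Series with geometric tails *)

Section SeriesTails.
Context (R : realType).
Implicit Types (u : nat -> R) (U K : R).

Lemma geometric_tail u K m N : (forall k, (m <= k)%N -> `|u k| <= K * 2^-1 ^+ k) ->
  (m <= N)%N ->
  `|\sum_(k < N) u k - \sum_(k < m) u k| <= K * 2 * 2^-1 ^+ m.
Proof.
move=> uK mN.
have K0 : 0 <= K * 2^-1 ^+ m by rewrite (le_trans _ (uK m _)).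
suff H : `|\sum_(k < N) u k - \sum_(k < m) u k| <= K * 2 * 2^-1 ^+ m - K * 2 * 2^-1 ^+ N.
  have : 0 <= K * 2^-1 ^+ N.
    rewrite (_ : _ ^+ N = 2^-1 ^+ m * 2^-1 ^+ (N - m)); last by rewrite -exprD subnKC.
    by rewrite mulrA mulr_ge0// exprn_ge0.
  move: H; lra.
elim: N mN => [|N IH]; first by rewrite leqn0 => /eqP->; rewrite !subrr normr0.
rewrite leq_eqVlt => /predU1P[<-|]; first by rewrite !subrr normr0.
rewrite ltnS => mN; rewrite big_ord_recr /= addrAC (le_trans (ler_normD _ _))//.
rewrite (le_trans (lerD (IH mN) (uK N mN)))// exprS.
have : 2 * 2^-1 = 1 :> R by rewrite mulfV.
set q := _ ^+ N; set p := _ ^+ m; move: (2^-1) => h hE.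
have -> : K * 2 * (h * q) = K * q * (2 * h) by ring.
by rewrite hE; lra.
Qed.

Definition sums_to u U := (\sum_(k < N) u k) @[N --> \oo] --> U.

Lemma sums_to_tail u U K m : sums_to u U ->
  (forall k, (m <= k)%N -> `|u k| <= K * 2^-1 ^+ k) ->
  `|U - \sum_(k < m) u k| <= K * 2 * 2^-1 ^+ m.
Proof.
move=> uU uK; apply/ler_addgt0Pr => e e0.
have /cvgrPdist_le/(_ _ e0)[N _ NP] := uU.
have := NP (maxn N m) (leq_maxl _ _); have := geometric_tail uK (leq_maxr N m).
set S := \sum_(k < maxn N m) _ => H1 H2.
by rewrite -(subrKA S) addrC (le_trans (ler_normD _ _))// lerD.
Qed.

Lemma sums_to_bound u U K : (forall N, `|\sum_(k < N) u k| <= K) ->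
  sums_to u U -> `|U| <= K.
Proof.
move=> uK uU; apply/ler_addgt0Pr => e e_gt0.
have /cvgrPdist_le/(_ _ e_gt0)[N _ NP] := uU.
have := NP N (leqnn N) => /= UN.
rewrite -(subrK (\sum_(k < N) u k) U) addrC (le_trans (ler_normD _ _))// lerD//.
Qed.

Lemma half_power_small (K e : R) : 0 <= K -> 0 < e ->
  exists N, forall n, (N <= n)%N -> K * 2^-1 ^+ n <= e.
Proof.
move=> K0 e0.
have D0 : 0 < K + 1 by rewrite ltr_wpDl.
have h : `|2^-1 : R| < 1 by rewrite ger0_norm// invf_lt1// ltr1n.
have /cvgrPdist_le/(_ _ (divr_gt0 e0 D0))[N _ NP] := cvg_expr h.
exists N => n Nn; have := NP n Nn; rewrite /= sub0r normrN ger0_norm ?exprn_ge0//.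
rewrite ler_pdivlMr//; have : 0 <= 2^-1 ^+ n :> R by rewrite exprn_ge0.
nra.
Qed.

Lemma sums_to_of_tail u U K m :
  (forall N, (m <= N)%N -> `|U - \sum_(k < N) u k| <= K * 2^-1 ^+ N) -> sums_to u U.
Proof.
move=> H; apply/cvgrPdist_le => /= e e0.
have [N NP] := half_power_small (normr_ge0 K) e0.
exists (maxn N m) => // n /=; rewrite geq_max => /andP[Nn mn].
rewrite (le_trans (H _ mn))// (le_trans _ (NP _ Nn))//.
by rewrite ler_wpM2r ?exprn_ge0// ler_norm.
Qed.

Lemma sums_to_finite u m : (forall k, (m <= k)%N -> u k = 0) -> sums_to u (\sum_(k < m) u k).
Proof.
move=> u0; apply: (@sums_to_of_tail _ _ 0 m) => N mN.
have := @geometric_tail u 0 m N; rewrite !mul0r distrC; apply=> // k mk.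
by rewrite u0// normr0 mul0r.
Qed.

Lemma sums_to_lin (a : R) u v U V : sums_to u U -> sums_to v V ->
  sums_to (fun k => a * u k + v k) (a * U + V).
Proof.
move=> uU vV; rewrite /sums_to.
under eq_fun do rewrite big_split /= -mulr_sumr.
by apply: cvgD => //; apply: cvgM => //; exact: cvg_cst.
Qed.

Section GeneralizedLimit.
Context (L : (nat -> R) -> R) (LP : generalized_limit L).

Lemma generalized_limitZ (a : R) u : bounded_seq u -> L (fun n => a * u n) = a * L u.
Proof.
have [Llin Lb _] := LP => ub.
have b0 : bounded_seq (fun=> 0 : R) by exists 0 => n; rewrite normr0.
have L0 : L (fun=> 0) = 0.
  by apply/eqP; rewrite -normr_le0; apply: Lb => n; rewrite normr0.
by have := Llin a u _ ub b0; rewrite L0 addr0 => <-; congr L; apply/funext => n; rewrite addr0.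
Qed.

Lemma bounded_seq_lin (a : R) u v : bounded_seq u -> bounded_seq v ->
  bounded_seq (fun n => a * u n + v n).
Proof.
move=> [Ku uK] [Kv vK]; exists (`|a| * Ku + Kv) => n.
by rewrite (le_trans (ler_normD _ _))// lerD// normrM ler_wpM2l.
Qed.

Lemma generalized_limit_sum (u : nat -> nat -> R) N :
  (forall k, bounded_seq (u^~ k)) ->
  bounded_seq (fun n => \sum_(k < N) u n k) /\
  L (fun n => \sum_(k < N) u n k) = \sum_(k < N) L (u^~ k).
Proof.
have [Llin Lb _] := LP => ub.
have b0 : bounded_seq (fun=> 0 : R) by exists 0 => n; rewrite normr0.
elim: N => [|N [bN IH]].
  under eq_fun do rewrite big_ord0; rewrite big_ord0; split=> //.
  by apply/eqP; rewrite -normr_le0; apply: Lb => n; rewrite normr0.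
have E : (fun n => \sum_(k < N.+1) u n k) = (fun n => 1 * (\sum_(k < N) u n k) + u n N).
  by apply/funext => n; rewrite big_ord_recr mul1r.
by rewrite E; split; [exact: bounded_seq_lin|rewrite Llin// mul1r IH big_ord_recr].
Qed.

(** The tails are bounded by a geometric series uniformly in [n], a bound that [L] preserves. *)
Lemma dominated_series (u : nat -> nat -> R) (U : nat -> R) (K : R) m :
  (forall n, sums_to (u n) (U n)) ->
  (forall k, bounded_seq (u^~ k)) -> bounded_seq U ->
  (forall n k, (m <= k)%N -> `|u n k| <= K * 2^-1 ^+ k) ->
  sums_to (fun k => L (u^~ k)) (L U).
Proof.
have [Llin Lb _] := LP => uU ub Ub uK.
apply: (@sums_to_of_tail _ _ (K * 2) m) => N mN.
have [bN <-] := generalized_limit_sum N ub.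
rewrite -mulN1r addrC -Llin//; apply: Lb => n.
rewrite mulN1r addrC; apply: sums_to_tail => // k Nk; apply: uK; exact: leq_trans Nk.
Qed.

End GeneralizedLimit.

End SeriesTails.

(** * Functionals attached to the nodes of a forest *)

Section Tree.
Context (R : realType) (Y : normedModType R).
Variables (z : nat -> nat -> Y) (w : nat -> nat -> dual Y) (cost : seq nat -> R).
Hypothesis wz : forall p n q m, w p n (z q m) = ((p == q) && (n == m))%:R.
Hypothesis cost_gt0 : forall s, 0 < cost s.

(** A node is the list of the choices made from its root, latest first; a
singleton is a root, and the empty list is not a node. *)
Fixpoint branch (s : seq nat) : dual Y :=
  if s is n :: s' then
    if s' is [::] then 0 else branch s' + cost s' *: w (pickle s') n
  else 0.

(** The numbers tau of a functional [T^* y + \sum_k b_k f_k]: at a root the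
coefficient of the corresponding [f k], elsewhere the coefficient of [y] along [w],
normalized by the cost of the edge. *)
Definition coordinate (y : dual Y) (b : nat -> R) (s : seq nat) : R :=
  if s is n :: s' then
    if s' is [::] then b n else y (z (pickle s') n) / cost s'
  else 0.

(** For a node [t] this is 1 if [t] is an ancestor of [l] or [l] itself, and 0 otherwise; counting
keeps the recursion additive. *)
Fixpoint occurrences (t l : seq nat) : nat :=
  (t == l) + (if l is _ :: l' then occurrences t l' else 0).

Lemma coordinate_lin a y y' b b' s :
  coordinate (a *: y + y') (fun k => a * b k + b' k) s =
  a * coordinate y b s + coordinate y' b' s.
Proof.
case: s => [|n [|m s]]; rewrite /coordinate; [by rewrite mulr0 addr0|by []|].
by rewrite dual_addE dual_scaleE mulrDl mulrA.
Qed.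

Lemma coordinate_branch (l t : seq nat) : l != [::] -> t != [::] ->
  coordinate (branch l) (fun k => (k == last 0%N l)%:R) t = (occurrences t l)%:R.
Proof.
move=> + tn; elim: l => // m l IH _; case: l IH => [_|m' l IH].
  case: t tn => [//|n [|n' t]] _ /=; first by rewrite eqseq_cons andbT addn0 addn0.
  by rewrite mul0r eqseq_cons andbF.
have {IH} := IH isT; set l' := m' :: l => IH.
rewrite [occurrences _ _]/= -/l' natrD -IH.
case: t tn IH => [//|n [|n' t]] _ IH.
  by rewrite /= !eqseq_cons andbF add0r.
set t' := n' :: t.
rewrite -[branch (m :: l')]/(branch l' + cost l' *: w (pickle l') m).
rewrite -[coordinate _ _ (n :: t')]/((branch l' + cost l' *: w (pickle l') m) (z (pickle t') n) / cost t').
rewrite -[coordinate _ _ (n :: t')]/(branch l' (z (pickle t') n) / cost t').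
rewrite dual_addE dual_scaleE mulrDl addrC wz; congr (_ + _).
rewrite eqseq_cons (inj_eq (pcan_inj pickleK)).
have [_|_] := eqVneq n m; last by rewrite andbF mulr0 mul0r.
rewrite andbT andTb.
by have [->|_] := eqVneq t' l'; rewrite ?mulr1 ?mulfV ?gt_eqF// mulr0 mul0r.
Qed.

(** The path from the root to [l] leaves each proper ancestor of [l] through exactly one child. *)
Lemma occurrences_children (l t : seq nat) N : (forall n, n \in l -> (n < N)%N) ->
  (\sum_(n < N) occurrences ((n : nat) :: t) l + (t == l) = occurrences t l)%N.
Proof.
elim: l => [|m l IH] lN /=.
  by rewrite big1 // addn0 add0n.
rewrite big_split /= -addnA [(_ + (t == _))%N]addnC addnA addnAC.
rewrite addnC; congr (_ + _)%N.
rewrite -IH => [|n nl]; last by apply: lN; rewrite inE nl orbT.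
rewrite addnC; congr (_ + _)%N.
have mN : (m < N)%N by apply: lN; rewrite inE eqxx.
rewrite (bigD1 (Ordinal mN))//= eqseq_cons eqxx /= big1 ?addn0// => n nm.
rewrite eqseq_cons (_ : (n == m :> nat) = false)//.
by apply: contraNF nm => /eqP nm; apply/eqP/val_inj.
Qed.

Lemma branch_children_sum (l t : seq nat) : l != [::] -> t != [::] -> t != l ->
  sums_to (fun n => coordinate (branch l) (fun k => (k == last 0%N l)%:R) (n :: t))
    (coordinate (branch l) (fun k => (k == last 0%N l)%:R) t).
Proof.
move=> ln tn tl.
have lN n : n \in l -> (n < (\max_(i <- l) i).+1)%N.
  by move=> nl; rewrite ltnS; exact: (@leq_bigmax_seq _ l xpredT id n nl isT).
have H N : (\max_(i <- l) i < N)%N -> \sum_(n < N) (occurrences ((n : nat) :: t) l)%:R = (occurrences t l)%:R :> R.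
  move=> mN; rewrite -natr_sum -(@occurrences_children l t N); last first.
    by move=> n /lN /leq_trans; apply.
  by rewrite (negbTE tl) addn0.
apply: (@sums_to_of_tail _ _ _ 0 (\max_(i <- l) i).+1) => N mN.
rewrite coordinate_branch// (eq_bigr (fun n : 'I_N => (occurrences ((n : nat) :: t) l)%:R)).
  by rewrite H// subrr normr0 mul0r.
by move=> n _; rewrite coordinate_branch.
Qed.

End Tree.

(** The tail of index [m] of the series of the [delta k * a k] is compared with [c m], for all [m] at once. *)
Lemma decay_exists (R : realType) (c a : nat -> R) :
  (forall m, 0 < c m) -> (forall k, 0 <= a k) ->
  exists delta : nat -> R, forall k,
    [/\ 0 < delta k, delta k <= 2^-1 ^+ k, delta k * a k <= 2^-1 ^+ k &
        forall m, (m <= k)%N -> delta k * a k <= c m / 4 * 2^-1 ^+ k].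
Proof.
move=> c0 a0.
have mu (k : nat) : exists mu, [/\ 0 < mu, mu <= 1 & forall m, (m < k)%N -> mu <= c m / 4].
  elim: k => [|k [mu [mu0 mu1 muc]]]; first by exists 1.
  exists (Num.min mu (c k / 4)); split.
  - by rewrite lt_min mu0 divr_gt0.
  - by rewrite ge_min mu1.
  - move=> m; rewrite ltnS leq_eqVlt => /predU1P[->|mk]; rewrite ge_min ?lexx ?orbT//.
    by rewrite muc.
suff /choice[delta H] (k : nat) : exists delta, [/\ 0 < delta, delta <= 2^-1 ^+ k, delta * a k <= 2^-1 ^+ k &
        forall m, (m <= k)%N -> delta * a k <= c m / 4 * 2^-1 ^+ k] by exists delta.
have [nu [nu0 nu1 nuc]] := mu k.+1.
have D0 : 0 < 1 + a k by rewrite ltr_pwDl.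
have h0 : 0 < 2^-1 ^+ k :> R by rewrite exprn_gt0.
have d1 : nu / (1 + a k) <= nu by rewrite ler_pdivrMr// ler_peMr ?lerDl// ltW.
have d2 : nu / (1 + a k) * a k <= nu.
  by rewrite mulrAC ler_pdivrMr//; apply: ler_wpM2l; [exact: ltW|rewrite lerDr].
exists (2^-1 ^+ k * (nu / (1 + a k))); split.
- by rewrite mulr_gt0// divr_gt0.
- by apply: ler_piMr; [exact: ltW|exact: le_trans d1 nu1].
- by rewrite -mulrA; apply: ler_piMr; [exact: ltW|exact: le_trans d2 nu1].
- move=> m mk; rewrite -[leLHS]mulrA [leLHS]mulrC; apply: ler_wpM2r; first exact: ltW.
  by rewrite (le_trans d2)// nuc.
Qed.

(** * The subspace and its closures *)

Section Construction.
Context (R : realType) (X Y : completeNormedModType R) (T : {linear X -> Y}).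
Context (cT : continuous T).
Variables (f : nat -> dual X) (c C delta : nat -> R).
Variables (z : nat -> nat -> Y) (w : nat -> nat -> dual Y).
Hypothesis c_gt0 : forall n, 0 < c n.
Hypothesis f_lower : forall n (a : nat -> R) (y : dual Y),
  let g := \sum_(i < n) a i *: f i + adjoint cT y in
  c n * `|y| <= `|g| /\ forall i, (i < n)%N -> c n * `|a i| <= `|g|.
Hypothesis wz : forall p n q m, w p n (z q m) = ((p == q) && (n == m))%:R.
Hypothesis zC : forall p N, `|\sum_(n < N) z p n| <= C p.
Hypothesis w_null : forall p, wstar_cvg (fun n => adjoint cT (w p n)) 0.
Hypothesis deltaP : forall k, [/\ 0 < delta k, delta k <= 2^-1 ^+ k,
  delta k * `|f k| <= 2^-1 ^+ k &
  forall m, (m <= k)%N -> delta k * `|f k| <= c m / 4 * 2^-1 ^+ k].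
Variables (A : Ord) (e0 : nat -> A) (E : A -> nat -> option A).
Hypothesis E_lt : forall i n j, E i n = Some j -> ord_rel j i.
Hypothesis E_cofinal : forall i j, ord_rel j i ->
  exists N, forall n, (N <= n)%N -> exists j', E i n = Some j' /\ ~ ord_rel j' j.
Hypothesis E_some : forall i j n, ord_rel j i -> E i n <> None.

Fixpoint label (s : seq nat) : option A :=
  if s is n :: s' then
    if s' is [::] then Some (e0 n)
    else if label s' is Some i then E i n else None
  else None.

(** With this cost the row of [s] contributes to its coordinate at
most [delta (head s)] times the norm of [y]; see [coordinate_small]. *)
Definition edge_cost (s : seq nat) : R := (C (pickle s) + 1) / delta (head 0%N s).

Definition vertex (s : seq nat) : dual X :=
  f (last 0%N s) + adjoint cT (branch w edge_cost s).

(** The linear span of the leaf vertices, as the intersection of all subspaces containing them. *)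
Definition leaf_span : set (dual X) := [set g | forall S, is_subspace S ->
  (forall l, l != [::] -> label l = None -> S (vertex l)) -> S g].

Local Notation coord := (coordinate z edge_cost).

Definition represents (g : dual X) (y : dual Y) (b : nat -> R) :=
  forall x, sums_to (fun k => b k * f k x) (g x - y (T x)).

(** The invariant of the closure of order [j], where the roots before [m] are
disregarded: below a root from [m] on, the coordinate of every
node whose label is at least [j] is the sum of those of its children. *)
Definition tame (j : A) (m : nat) (g : dual X) := exists y b,
  represents g y b /\
  forall t i, t != [::] -> (m <= last 0 t)%N -> label t = Some i -> ~ ord_rel i j ->
    sums_to (fun n => coord y b (n :: t)) (coord y b t).

Lemma C_ge0 p : 0 <= C p.
Proof. by rewrite (le_trans _ (zC p 0)). Qed.

Lemma edge_cost_gt0 s : 0 < edge_cost s.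
Proof.
by rewrite /edge_cost divr_gt0 ?ltr_wpDl ?C_ge0//; have [] := deltaP (head 0%N s).
Qed.

(** The partial sums of the row of [t] are bounded by [C]. *)
Lemma coordinate_small y b t : t != [::] ->
  sums_to (fun n => coord y b (n :: t)) (coord y b t) ->
  `|coord y b t| <= delta (head 0%N t) * `|y|.
Proof.
move=> tn; apply: sums_to_bound => N.
have -> : \sum_(n < N) coord y b (nat_of_ord n :: t) =
    y (\sum_(n < N) z (pickle t) n) / edge_cost t.
  by rewrite dual_sum mulr_suml; apply: eq_bigr => n _; case: (t) tn.
have d0 : 0 < delta (head 0%N t) by have [] := deltaP (head 0%N t).
have D0 : 0 < C (pickle t) + 1 by rewrite ltr_wpDl ?C_ge0.
rewrite normrM normfV (gtr0_norm (edge_cost_gt0 t)) /edge_cost invf_div.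
rewrite mulrA ler_pdivrMr//.
have ub := dual_ub y (\sum_(n < N) z (pickle t) n).
have qp : `|\sum_(n < N) z (pickle t) n| <= C (pickle t) + 1.
  by rewrite (le_trans (zC _ _))// lerDl.
have := ler_wpM2r (ltW d0) (le_trans ub (ler_wpM2l (normr_ge0 y) qp)); lra.
Qed.

(** The coefficients from [m] on contribute at most [c m / 2 * |y|] to the norm, half of the
lower bound [c m * |y|] available for the finite part. *)
Lemma coefficient_bound m g y b : represents g y b ->
  (forall k, (m <= k)%N -> `|b k| <= delta k * `|y|) ->
  c m * `|y| <= 2 * `|g| /\ forall k, (k < m)%N -> c m * `|b k| <= 2 * `|g|.
Proof.
move=> gyb bm.
pose g0 := \sum_(i < m) b i *: f i + adjoint cT y.
have c2 : 0 <= c m / 2 by have := c_gt0 m; lra.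
have c4 : 0 <= c m / 4 by have := c_gt0 m; lra.
have [/= yg0 bg0] := f_lower m b y.
have tail : `|g - g0| <= c m / 2 * `|y|.
  apply: dual_norm_le => [|x]; first exact: mulr_ge0.
  have bK k : (m <= k)%N -> `|b k * f k x| <= c m / 4 * `|y| * `|x| * 2^-1 ^+ k.
    move=> mk; rewrite normrM.
    have [d0 _ _ /(_ m mk) dk] := deltaP k.
    have h1 : `|b k| * `|f k x| <= (delta k * `|y|) * (`|f k| * `|x|).
      by apply: ler_pM => //; [exact: bm|exact: dual_ub].
    rewrite (le_trans h1)//.
    have h2 : 0 <= `|y| * `|x| by rewrite mulr_ge0.
    have := ler_wpM2r h2 dk; set q := 2^-1 ^+ k; lra.
  have := sums_to_tail (gyb x) bK.
  rewrite dual_subE /g0 dual_addE adjointE (dual_sumE _ (fun i => b i *: f i)) opprD addrA addrAC.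
  move=> H; rewrite (le_trans H)//.
  have : 0 <= c m / 4 * `|y| * `|x| by apply: mulr_ge0 => //; exact: mulr_ge0.
  have : 2^-1 ^+ m <= 1 :> R by rewrite exprn_ile1// invf_le1// ler1n.
  move=> h1 h2; have := ler_wpM2l h2 h1; lra.
have g0g : `|g0| <= `|g| + c m / 2 * `|y|.
  by rewrite -(subKr g g0) (le_trans (ler_normB _ _))// lerD2l.
rewrite -/g0 in yg0 bg0.
have yg : c m * `|y| <= 2 * `|g| by lra.
split=> // k km; have := bg0 k km; lra.
Qed.

Lemma tame_bound j m g : (forall k, (m <= k)%N -> ~ ord_rel (e0 k) j) -> tame j m g ->
  exists y b, [/\ represents g y b,
    forall t i, t != [::] -> (m <= last 0 t)%N -> label t = Some i -> ~ ord_rel i j ->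
      sums_to (fun n => coord y b (n :: t)) (coord y b t) /\
      `|coord y b t| <= delta (head 0%N t) * `|y|,
    forall k, (m <= k)%N -> `|b k| <= delta k * `|y|,
    c m * `|y| <= 2 * `|g| &
    forall k, (k < m)%N -> c m * `|b k| <= 2 * `|g|].
Proof.
move=> e0j [y [b [gyb yb]]].
have bm k : (m <= k)%N -> `|b k| <= delta k * `|y|.
  by move=> mk; apply: (@coordinate_small y b [:: k]) => //; apply: (yb _ (e0 k)) => //; exact: e0j.
have [yg bg] := coefficient_bound gyb bm.
exists y, b; split=> // t i tn mt ti ij; split; first exact: (yb _ i).
by apply: coordinate_small => //; exact: (yb _ i).
Qed.

Lemma tame_subspace j m : is_subspace (tame j m).
Proof.
split.
  exists 0, (fun=> 0); split=> [x|t i tn _ _ _].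
    rewrite (_ : _ - _ = \sum_(k < 0) (0 * f k x)); last by rewrite big_ord0 subr0.
    by apply: (@sums_to_finite _ (fun k => 0 * f k x)) => k _; rewrite mul0r.
  have c0 s : coord 0 (fun=> 0) s = 0 by case: s => [|n [|k s]] //=; rewrite mul0r.
  have := @sums_to_finite _ (fun k => coord 0 (fun=> 0) (k :: t)) 0%N (fun k _ => c0 _).
  by rewrite big_ord0 c0.
move=> a g g' [y [b [gyb yb]]] [y' [b' [gyb' yb']]].
exists (a *: y + y'), (fun k => a * b k + b' k); split=> [x|t i tn mt ti ij].
  rewrite !dual_addE !dual_scaleE.
  rewrite (_ : _ - _ = a * (g x - y (T x)) + (g' x - y' (T x))); last by ring.
  have -> : (fun k => (a * b k + b' k) * f k x) = (fun k => a * (b k * f k x) + b' k * f k x).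
    by apply/funext => k; ring.
  exact: sums_to_lin.
rewrite coordinate_lin.
have -> : (fun n => coord (a *: y + y') (fun k => a * b k + b' k) (n :: t)) =
    (fun n => a * coord y b (n :: t) + coord y' b' (n :: t)).
  by apply/funext => n; rewrite coordinate_lin.
by apply: sums_to_lin; [exact: (yb _ i)|exact: (yb' _ i)].
Qed.

Lemma tame_leaf j m l : l != [::] -> label l = None -> tame j m (vertex l).
Proof.
move=> ln ll; exists (branch w edge_cost l), (fun k => (k == last 0%N l)%:R); split.
  move=> x; rewrite /vertex dual_addE adjointE addrK.
  pose u k := (k == last 0%N l)%:R * f k x : R.
  have -> : f (last 0%N l) x = \sum_(k < (last 0%N l).+1) u k.
    by rewrite big_ord_recr /= {2}/u eqxx mul1r big1 ?add0r// => k _; rewrite /u ltn_eqF// mul0r.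
  by apply: sums_to_finite => k lk; rewrite /u gtn_eqF// mul0r.
move=> t i tn _ ti _; apply: branch_children_sum => //; first exact: edge_cost_gt0.
by apply/eqP => tl; move: ti; rewrite tl ll.
Qed.

(** Induction on [j].  An element of the closure is the limit of tame functionals
of an earlier order [j'], whose data are bounded by [tame_bound]; their generalized
limits represent the limit functional.  For a node [t] with label at least [j], hence above [j'],
almost all children have labels at least [j'], so
their coordinates are dominated by [delta] and the sum over the children passes to the limit. *)
Lemma tame_closure j m b : (forall k, (m <= k)%N -> ~ ord_rel (e0 k) j) ->
  is_segment b j -> wstar_closure leaf_span b `<=` tame j m.
Proof.
elim/(well_founded_ind (@ord_wf A)): j b => j IH b e0j bj g; rewrite wstar_closureE => -[[_ Mg]|].
  by apply: Mg; [exact: tame_subspace|move=> l; exact: tame_leaf].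
move=> [b' [b'b [u [ub' ug]]]].
have [j' j'j b'j'] := is_segment_lt bj b'b.
have e0j' k : (m <= k)%N -> ~ ord_rel (e0 k) j'.
  by move=> mk kj; apply: (e0j k mk); exact: ord_trans kj j'j.
have uT n : tame j' m (u n) by apply: (IH j' j'j b' e0j' b'j').
have /choice[yb ybP] n := tame_bound e0j' (uT n).
have {ybP} /choice[bb ybP] n := ybP n.
have [K uK] := wstar_cvg_bounded ug.
have K0 : 0 <= K by rewrite (le_trans _ (uK 0%N)).
pose Q := 2 * K / c m.
have Q0 : 0 <= Q by rewrite divr_ge0 ?mulr_ge0// ltW.
have cQ (r : R) n : c m * r <= 2 * `|u n| -> r <= Q.
  by move=> H; rewrite /Q ler_pdivlMr// mulrC (le_trans H)// ler_wpM2l.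
have yQ n : `|yb n| <= Q by have [_ _ _ H _] := ybP n; exact: cQ H.
have bQ k n : (m <= k)%N -> `|bb n k| <= delta k * Q.
  move=> mk; have [_ _ /(_ k mk) H _ _] := ybP n; rewrite (le_trans H)//.
  by apply: ler_wpM2l => //; have [/ltW] := deltaP k.
have bB k : bounded_seq (fun n => bb n k).
  have [km|mk] := ltnP k m; last by exists (delta k * Q) => n; exact: bQ.
  by exists Q => n; have [_ _ _ _ /(_ k km)] := ybP n; exact: cQ.
have [L LP] := generalized_limit_exists R.
have [Llin Lb Llim] := LP.
have [y yK yE] := wstar_limit_exists LP yQ.
pose bl k := L (fun n => bb n k).
have yB t : bounded_seq (fun n => yb n t).
  by exists (Q * `|t|) => n; rewrite (le_trans (dual_ub _ _))// ler_wpM2r.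
have cB t : bounded_seq (fun n => coord (yb n) (bb n) t) /\
    L (fun n => coord (yb n) (bb n) t) = coord y bl t.
  case: t => [|k [|k' t]] /=.
  - by split; [exists 0 => n; rewrite normr0|apply: Llim; exact: cvg_cst].
  - by split; [exact: bB|].
  - set s := k' :: t.
    have E1 : (fun n => yb n (z (pickle s) k) / edge_cost s) =
        (fun n => (edge_cost s)^-1 * yb n (z (pickle s) k)).
      by apply/funext => n; rewrite mulrC.
    rewrite E1; split; last by rewrite generalized_limitZ// yE mulrC.
    have [Ky yKy] := yB (z (pickle s) k).
    by exists (`|(edge_cost s)^-1| * Ky) => n; rewrite normrM ler_wpM2l.
exists y, bl; split=> [x|t i tn mt ti ij].
  have -> : g x - y (T x) = L (fun n => u n x - yb n (T x)).
    have ux : bounded_seq (fun n => u n x).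
      by exists (K * `|x|) => n; rewrite (le_trans (dual_ub _ _))// ler_wpM2r.
    have -> : (fun n => u n x - yb n (T x)) = (fun n => (-1) * yb n (T x) + u n x).
      by apply/funext => n; rewrite mulN1r addrC.
    by rewrite Llin// mulN1r -yE (Llim _ (g x) (ug x)) addrC.
  have -> : (fun k => bl k * f k x) = (fun k => L (fun n => bb n k * f k x)).
    apply/funext => k; rewrite mulrC -generalized_limitZ//.
    by congr L; apply/funext => n; rewrite mulrC.
  apply: (dominated_series LP (K := Q * `|x|) (m := m)) => [n|k||n k mk].
  - by have [H _ _ _ _] := ybP n; exact: H.
  - have [Kb bKb] := bB k; exists (Kb * `|f k x|) => n.
    by rewrite normrM ler_wpM2r.
  - exists (K * `|x| + Q * `|T x|) => n; rewrite (le_trans (ler_normB _ _))// lerD//;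
      by rewrite (le_trans (dual_ub _ _))// ler_wpM2r.
  - rewrite normrM.
    have h1 : `|bb n k| * `|f k x| <= (delta k * Q) * (`|f k| * `|x|).
      by apply: ler_pM => //; [exact: bQ|exact: dual_ub].
    rewrite (le_trans h1)//; have [_ _ dk _] := deltaP k.
    have h2 : 0 <= Q * `|x| by rewrite mulr_ge0.
    have := ler_wpM2r h2 dk; set q := 2^-1 ^+ k; lra.
have j'i : ord_rel j' i.
  by have [ij'|[->//|ji]] := ord_trichotomy i j; [exfalso; exact: ij|exact: ord_trans j'j ji].
(* From [N0] on, the children of [t] have labels that are at least [j']. *)
have [N0 N0P] := E_cofinal j'i.
have -> : coord y bl t = L (fun n => coord (yb n) (bb n) t) by have [] := cB t.
have -> : (fun n => coord y bl (n :: t)) = (fun k => L (fun n => coord (yb n) (bb n) (k :: t))).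
  by apply/funext => k; have [] := cB (k :: t).
apply: (dominated_series LP (K := Q) (m := N0)) => [n|k||n k Nk].
- have [_ H _ _ _] := ybP n.
  have ij' : ~ ord_rel i j' by move=> ij'; apply: ij; exact: ord_trans ij' j'j.
  by have [] := H t i tn mt ti ij'.
- by have [] := cB (k :: t).
- by have [] := cB t.
- have [i' [ki' i'j']] := N0P k Nk.
  have [_ H _ _ _] := ybP n.
  have lt : (m <= last 0 (k :: t))%N by case: (t) tn mt.
  have lab : label (k :: t) = Some i' by case: (t) tn ti => // k' t' _ /= ->.
  have [_ h] := H (k :: t) i' isT lt lab i'j'.
  rewrite (le_trans h)//= mulrC; apply: ler_pM => //.
  + by have [/ltW] := deltaP k.
  + by have [] := deltaP k.
Qed.

(** At a vector [x] killed by the first [K] functionals [f k], only [y (T x)] and the tail from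
[K] on contribute to [g x]; the tail is small for large [K], and by strict
singularity [x] may be chosen with [T x] small. *)
Lemma tame_nowhere_norming j m (N : set (dual X)) : strictly_singular T ->
  (forall k, (m <= k)%N -> ~ ord_rel (e0 k) j) -> N `<=` tame j m -> nowhere_norming N.
Proof.
move=> ssT e0j NT L sL nL [r r0 rP].
pose Q := 2 / c m.
have Q0 : 0 < Q by rewrite divr_gt0.
have [K0 K0P] := half_power_small (K := Q * 2) (e := r / 4) (ltW (mulr_gt0 Q0 (ltr0n R 2))) (divr_gt0 r0 (ltr0n R 4)).
pose K := maxn K0 m.
have [x [[Lx fx] Tx]] := strictly_singular_small cT ssT (subspace_kernels f K sL)
  (@infinite_dim_kernels _ _ _ f K sL nL) (divr_gt0 r0 (mulr_gt0 (ltr0n R 4) Q0)).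
have x0 : 0 < `|x|.
  by rewrite normr_gt0; apply/eqP => x0; move: Tx; rewrite x0 linear0 !normr0 mulr0 ltxx.
have := rP x Lx; apply/negP; rewrite -ltNge.
apply: (@le_lt_trans _ _ (r / 2 * `|x|)); last by rewrite ltr_pM2r// ltr_pdivrMr// ltr_pMr// ltr1n.
have bnd g : N g -> `|g| = 1 -> `|g x| <= r / 2 * `|x|.
  move=> /NT /(tame_bound e0j)[y [b [gyb _ bm yg _]]] g1.
  have yQ : `|y| <= Q by rewrite /Q ler_pdivlMr// mulrC (le_trans yg)// g1 mulr1.
  have bK k : (K <= k)%N -> `|b k * f k x| <= Q * `|x| * 2^-1 ^+ k.
    move=> Kk; have mk : (m <= k)%N by rewrite (leq_trans _ Kk)// leq_maxr.
    have [d0 _ dk _] := deltaP k.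
    have h0 : `|b k| <= delta k * Q.
      by rewrite (le_trans (bm k mk))//; apply: ler_wpM2l => //; exact: ltW.
    have h1 : `|b k| * `|f k x| <= (delta k * Q) * (`|f k| * `|x|).
      by apply: ler_pM => //; exact: dual_ub.
    rewrite normrM (le_trans h1)//.
    have h2 : 0 <= Q * `|x| by rewrite mulr_ge0// ltW.
    have := ler_wpM2r h2 dk; set q := 2^-1 ^+ k; lra.
  have := sums_to_tail (gyb x) bK.
  rewrite big1 ?subr0 => [H|k _]; last by rewrite fx ?mulr0.
  have H1 := dual_ub y (T x).
  have H2 : `|y| * `|T x| <= r / 4 * `|x|.
    rewrite (@le_trans _ _ (Q * (r / (4 * Q) * `|x|)))//; first by apply: ler_pM => //; exact: ltW.
    by rewrite mulrA (_ : Q * (r / (4 * Q)) = r / 4)//; field; rewrite gt_eqF.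
  have H3 := ler_wpM2r (ltW x0) (K0P K (leq_maxl _ _)).
  rewrite -(subrK (y (T x)) (g x)) (le_trans (ler_normD _ _))//.
  move: H H3; set q := 2^-1 ^+ K; lra.
have [[g [Ng g1]]|ng] := pselect (exists g, N g /\ `|g| = 1).
  apply: ge_sup; first by exists `|g x|, g.
  by move=> _ [h [Nh h1] <-]; exact: bnd.
rewrite (_ : [set _ | _ in _] = set0); last first.
  by apply/seteqP; split=> // v [g [Ng g1] _]; apply: ng; exists g.
by rewrite sup0 mulr_ge0// divr_ge0// ltW.
Qed.

Lemma leaf_span_subspace : is_subspace leaf_span.
Proof.
split; first by move=> S sS _; case: sS.
move=> a u v uM vM S sS Sl; have [_ Sl'] := sS.
by apply: Sl'; [exact: uM|exact: vM].
Qed.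

Lemma leaf_span_vertex l : l != [::] -> label l = None -> leaf_span (vertex l).
Proof. by move=> ln ll S _; apply. Qed.

Lemma vertex_children_cvg s : s != [::] -> wstar_cvg (fun n => vertex (n :: s)) (vertex s).
Proof.
move=> sn x.
have E1 n : vertex (n :: s) x = vertex s x + edge_cost s * adjoint cT (w (pickle s) n) x.
  case: s sn => // k s _; rewrite /vertex !dual_addE !adjointE -addrA.
  by rewrite [branch _ _ (n :: _)]/= dual_addE dual_scaleE.
under eq_fun do rewrite E1.
have : (vertex s x + edge_cost s * adjoint cT (w (pickle s) n) x : R) @[n --> \oo] -->
    (vertex s x + edge_cost s * (0 : dual X) x : R).
  apply: cvgD; first exact: cvg_cst.
  by apply: cvgM; [exact: cvg_cst|exact: w_null].
by rewrite [(0 : dual X) x]/(0 : R) mulr0 addr0.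
Qed.

(** Induction on the label: the children of [s] lie in the closure of the order
given by [i], being leaves if [i] is least, and they converge to [s]. *)
Lemma vertex_closure i s b : label s = Some i -> ord_lt (segment i) b ->
  wstar_closure leaf_span b (vertex s).
Proof.
elim/(well_founded_ind (@ord_wf A)): i s b => i IH s b si ib.
have sn : s != [::] by apply/eqP => s0; move: si; rewrite s0.
rewrite wstar_closureE; right; exists (segment i), ib.
exists (fun n => vertex (n :: s)); split; last exact: vertex_children_cvg.
move=> n; have lE : label (n :: s) = E i n.
  by case: (s) sn si => // k s' _ /= ->.
case En : (E i n) => [j|].
  by apply: (IH j) => //; [exact: E_lt En|by rewrite lE|apply: segment_lt_segment; exact: E_lt En].
rewrite wstar_closureE; left; split; last by apply: leaf_span_vertex => //; rewrite lE.
by move=> [j ji]; exact: E_some ji En.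
Qed.

(** The root vertices are the [f k] themselves, and their labels lie in [A]. *)
Lemma closure_full (kdense : forall g, exists kappa : nat -> nat,
    wstar_cvg (fun n => f (kappa n)) g) :
  wstar_closure leaf_span (ord_succ A) = [set: dual X].
Proof.
apply/seteqP; split=> // g _; rewrite wstar_closureE; right.
exists A, (ord_lt_succ A); have [kappa kg] := kdense g.
exists (fun n => f (kappa n)); split=> // n.
have -> : f (kappa n) = vertex [:: kappa n].
  by apply: dualP => x; rewrite /vertex dual_addE adjointE addr0.
exact: (vertex_closure (i := e0 (kappa n))) (segment_lt _).
Qed.

End Construction.

(** * Assembling the construction *)

(** The identity matrix of size [n + 1] would factor through dimension [n]. *)
Lemma biorthogonal_infinite_dim (R : realType) (Y : normedModType R)
    (z : nat -> Y) (w : nat -> dual Y) :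
  (forall i j, w i (z j) = (i == j)%:R) -> ~ finite_dim [set: Y].
Proof.
move=> wz [n [e eP]].
have /choice[a aP] (i : nat) : exists a : 'I_n -> R, z i = \sum_k a k *: e k := eP (z i) I.
pose M : 'M[R]_(n.+1, n) := \matrix_(i, k) a i k.
pose N : 'M[R]_(n, n.+1) := \matrix_(k, j) w j (e k).
have MN : M *m N = 1%:M.
  apply/matrixP => i j; rewrite !mxE.
  transitivity (w j (z i) : R); last by rewrite wz eq_sym.
  rewrite aP linear_sum; apply: eq_bigr => k _.
  by rewrite !mxE -dualZ.
have := leq_trans (mxrankM_maxl M N) (rank_leq_col M).
by rewrite MN mxrank1 ltnn.
Qed.

Lemma finite_dim_image (R : realType) (X Y : normedModType R) (T : {linear X -> Y}) :
  range T = [set: Y] -> finite_dim [set: X] -> finite_dim [set: Y].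
Proof.
move=> sT [n [e eP]]; exists n, (fun i => T (e i)) => y _.
have : range T y by rewrite sT.
move=> [x _ <-]; have [a ->] := eP x I; exists a.
by rewrite linear_sum; apply: eq_bigr => k _; rewrite linearZ.
Qed.

(** [None] marks leaves; it is the value exactly when [i] is the least element. *)
Lemma fundamental_sequences (A : Ord) : countable [set: A] ->
  exists E : A -> nat -> option A,
    [/\ forall i n j, E i n = Some j -> ord_rel j i,
        forall i j, ord_rel j i -> exists N, forall n, (N <= n)%N ->
          exists j', E i n = Some j' /\ ~ ord_rel j' j &
        forall i j n, ord_rel j i -> E i n <> None].
Proof.
move=> cA.
have /choice[E EP] (i : A) : exists e : nat -> option A,
    [/\ forall n j, e n = Some j -> ord_rel j i,
        forall j, ord_rel j i -> exists N, forall n, (N <= n)%N ->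
          exists j', e n = Some j' /\ ~ ord_rel j' j &
        forall j n, ord_rel j i -> e n <> None].
  have [ne|emp] := pselect (exists j, ord_rel j i); last first.
    by exists (fun=> None); split=> // j *; exfalso; apply: emp; exists j.
  have [e [ei ej]] := cofinal_sequence cA ne.
  exists (fun n => Some (e n)); split=> [n j [<-]//|j /ej[N NP]|//].
  by exists N => n Nn; exists (e n); split=> //; exact: NP.
by exists E; split=> i; have [H1 H2 H3] := EP i.
Qed.

Theorem mainTheorem1 (R : realType) (X : completeNormedModType R)
  (hX : separable_space X)
  (hT : exists (Y : completeNormedModType R) (T : {linear X -> Y}),
      [/\ ~ quasireflexive Y, continuous T, range T = [set: Y]
        & strictly_singular T])
  (alpha : Ord) (halpha : countable [set: alpha]) :
  exists M : set (dual X),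
    [/\ is_subspace M,
        wstar_closure M (ord_succ alpha) = [set: dual X]
      & forall beta : Ord, ord_lt beta alpha ->
          nowhere_norming (wstar_closure M beta)].
Proof.
(* For alpha = 0 the whole dual is a solution, and no beta is smaller. *)
have [[i0 _]|alpha0] := pselect (exists i : alpha, True); last first.
  exists [set: dual X]; split=> //.
    apply/seteqP; split=> // g _; rewrite wstar_closureE; right.
    exists alpha, (ord_lt_succ alpha), (fun=> g); split; last by move=> x; exact: cvg_cst.
    by move=> _; rewrite wstar_closure0// => i; apply: alpha0; exists i.
  by move=> beta [h [i _]]; exfalso; apply: alpha0; exists i.
have [Y [T [nqr cT sT ssT]]] := hT.
have [x xd] := separable_sequence hX.
have [z [w [C [B [wz zC wB wx]]]]] := nonquasireflexive_array (fun i => T (x i)) nqr.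
have nX : ~ finite_dim [set: X].
  move=> /(finite_dim_image sT); apply: (@biorthogonal_infinite_dim _ _ (z 0%N) (w 0%N)).
  by move=> i j; rewrite wz.
have nW := adjoint_range_infinite_codim (cT := cT) sT ssT nX.
have [f [find fdense]] := independent_wstar_dense hX (adjoint_range_closed cT sT) nW.
have [c [c0 cP]] := independent_lower_bound sT find.
have [delta deltaP] := decay_exists c0 (fun k => normr_ge0 (f k)).
have [E [E1 E2 E3]] := fundamental_sequences halpha.
have [|e0 [_ e0P]] := cofinal_sequence (P := fun=> True) halpha; first by exists i0.
have [K K0 TK] := operator_bound cT.
have w0 p : wstar_cvg (fun n => adjoint cT (w p n)) 0.
  apply: (wstar_cvg_dense (x := x) (K := B p * K)) => // [n|i].
    apply: dual_norm_le => [|v]; first by rewrite mulr_ge0// (le_trans _ (wB p 0%N)).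
    rewrite adjointE (le_trans (dual_ub _ _))// -mulrA.
    by apply: ler_pM => //; exact: wB.
  apply/cvgrPdist_le => /= e e_gt0; exists i => // n /= ni.
  by rewrite (wx p n i ni) subr0 normr0 ltW.
exists (leaf_span cT f C delta w e0 E); split.
- exact: leaf_span_subspace.
- exact: closure_full.
- move=> beta [h [i hi]]; have [m mP] := e0P i I.
  have hseg : is_segment beta i by exists h.
  exact: (tame_nowhere_norming c0 cP zC deltaP ssT mP
    (tame_closure c0 cP wz zC deltaP E2 mP hseg)).
Qed.
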